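(* Let $q$ be a prime power, $n\ge 3$ an odd integer, and let $\mathcal{BM}_n$ be the (Beelen-Montanucci) curve over $\mathbb{F}_{q^{2n}}$ defined by the affine equation $$y^{q^n+1}=(x^{q+1}-1)\,x^{q+1}\left(x^{q^2-1}-(x^{q+1}-1)^{q-1}\right)^{q+1}.$$ Put $M'=q^n+1$. Let $N$ be an integer with $2\le N\le q+1$, let $Q_1,\dots,Q_N$ be pairwise distinct places of $\mathbb{F}_{q^{2n}}(\mathcal{BM}_n)$ corresponding to roots of the polynomial $x^{q+1}-1$, and let $\mathbf{Q}=(Q_1,\dots,Q_N)$. Let $\Upsilon$ denote either $\Gamma$ or $\Lambda$, and let $\rho=0$ if $\Upsilon=\Gamma$ and $\rho=N-2$ if $\Upsilon=\Lambda$. For $1\le i\le M'-1$ put $$\beta(i)=q+1+(q^2-q-1)\left\lceil\frac{i(q+1)}{M'}\right\rceil-\left\lfloor\frac{i(q^3-q)}{M'}\right\rfloor-1 .$$ Then $$\widehat{\Upsilon}(\mathbf{Q})=\left\{(M'j_1+i,\dots,M'j_N+i): 1\le i\le M'-1,\ j_1,\dots,j_N\in\mathbb{Z},\ j_1+\cdots+j_N=\beta(i)+1-N+\rho\right\}$$ $$\cup\ \left\{(M'j_1,\dots,M'j_N): j_1,\dots,j_N\in\mathbb{Z},\ j_1+\cdots+j_N=\rho\right\}.$$ In particular, $$\Upsilon(\mathbf{Q})=\left\{(M'j_1+i,\dots,M'j_N+i): 1\le i\le M'-1,\ j_1,\dots,j_N\in\mathbb{N}_0,\ j_1+\cdots+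j_N=\beta(i)+1-N+\rho\right\}.$$
   Context: $\mathbb{N}$ is the set of positive integers and $\mathbb{N}_0=\mathbb{N}\cup\{0\}$. $\nu_P$ is the discrete valuation at a place $P$. The place of $\mathbb{F}_{q^{2n}}(\mathcal{BM}_n)$ corresponding to a root $\gamma$ of $x^{q+1}-1$ is the unique place lying over the zero of $x-\gamma$ in $\mathbb{F}_{q^{2n}}(x)$ (which is totally ramified in $\mathbb{F}_{q^{2n}}(\mathcal{BM}_n)/\mathbb{F}_{q^{2n}}(x)$). Let $F$ be a function field over a finite field and $\mathbf{Q}=(Q_1,\dots,Q_N)$ an $N$-tuple of distinct rational places. Let $R_{\mathbf{Q}}$ be the ring of functions in $F$ regular outside $\{Q_1,\dots,Q_N\}$. The generalized Weierstrass semigroup is $$\widehat{H}(\mathbf{Q})=\{(-\nu_{Q_1}(z),\dots,-\nu_{Q_N}(z))\in\mathbb{Z}^N : z\in R_{\mathbf{Q}}\setminus\{0\}\}.$$ Let $I=\{1,\dots,N\}$. For a nonempty $J\subsetneq I$ and $\alpha\in\mathbb{Z}^N$ let $$\nabla_J(\alpha)=\{\beta\in\widehat{H}(\mathbf{Q}) : \beta_j=\alpha_j \text{ for } j\in J,\ \beta_i<\alpha_i \text{ for } i\notin J\},\qquad \nabla(\alpha)=\bigcup_{i=1}^N\nabla_{\{i\}}(\alpha).$$ An element $\alpha\in\widehat{H}(\mathbf{Q})$ is maximal if $\nabla(\alpha)=\emptyset$. It is absolute maximal if it is maximal and $\nabla_J(\alpha)=\emptyset$ for every $J\subsetneq I$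 with $|J|\ge 2$; it is relative maximal if it is maximal and $\nabla_J(\alpha)\ne\emptyset$ for every $J\subsetneq I$ with $|J|\ge2$. $\widehat{\Gamma}(\mathbf{Q})$ and $\widehat{\Lambda}(\mathbf{Q})$ denote the sets of absolute maximal and relative maximal elements of $\widehat{H}(\mathbf{Q})$, respectively, and $$\Gamma(\mathbf{Q})=\widehat{\Gamma}(\mathbf{Q})\cap\mathbb{N}^N,\qquad \Lambda(\mathbf{Q})=\widehat{\Lambda}(\mathbf{Q})\cap\mathbb{N}^N.$$ *)

(* Defs.v *)
From HB Require Import structures.
From mathcomp Require Import all_boot all_order all_algebra all_field.
From mathcomp Require Import boolp classical_sets.

Set Implicit Arguments.
Unset Strict Implicit.
Unset Printing Implicit Defensive.

Import Order.TTheory GRing.Theory Num.Theory.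

Local Open Scope classical_set_scope.
Local Open Scope ring_scope.

Definition prime_power (q : nat) : Prop :=
  exists p e : nat, [/\ prime p, (0 < e)%N & q = (p ^ e)%N].

(* A place of E/K, given by its normalized discrete valuation, which is trivial
   on the constants (the image of iota).  The value at 0, which should be +oo,
   is set to 0: this makes the valuation determine the place (place_ext), and
   [0 <= ord P z] means that z is regular at P for every z, including z = 0. *)
Record place (K E : fieldType) (iota : {rmorphism K -> E}) := Place {
  ord :> E -> int;
  ord0 : ord 0 = 0;
  ordM : forall a b, a != 0 -> b != 0 -> ord (a * b) = ord a + ord b;
  ordD : forall a b, a != 0 -> b != 0 -> a + b != 0 ->
    Num.min (ord a) (ord b) <= ord (a + b);
  ord_const : forall c, c != 0 -> ord (iota c) = 0;
  ord_surj : exists t, ord t = 1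
}.

Lemma place_ext (K E : fieldType) (iota : {rmorphism K -> E})
  (P P' : place iota) : (forall z, ord P z = ord P' z) -> P = P'.
Proof.
case: P P' => [v a b c d e] [w a' b' c' d' e'] /= /funext vw.
by subst w; congr Place; apply: Prop_irrelevance.
Qed.

Section GeneralizedWeierstrassSemigroup.
Variables (K E : fieldType) (iota : {rmorphism K -> E}).
Variables (N : nat) (Q : 'I_N -> place iota).

Definition regular_outside : set E :=
  [set z | forall P : place iota, (forall k, P <> Q k) -> 0 <= ord P z].

Definition Hhat : set 'rV[int]_N :=
  [set a | exists z, [/\ regular_outside z, z != 0
                       & a = \row_k (- ord (Q k) z)]].

Definition nabla_set (J : {set 'I_N}) (a : 'rV[int]_N) : set 'rV[int]_N :=
  [set b | [/\ Hhat b, (forall j, j \in J -> b 0 j = a 0 j)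
             & (forall i, i \notin J -> b 0 i < a 0 i)]].

Definition nabla (a : 'rV[int]_N) : set 'rV[int]_N :=
  \bigcup_(i in [set: 'I_N]) nabla_set [set i]%SET a.

Definition maximal_elt (a : 'rV[int]_N) : Prop := Hhat a /\ nabla a = set0.

Definition GammaHat : set 'rV[int]_N :=
  [set a | maximal_elt a /\
     forall J : {set 'I_N}, J \proper [set: 'I_N]%SET -> (2 <= #|J|)%N ->
       nabla_set J a = set0].

Definition LambdaHat : set 'rV[int]_N :=
  [set a | maximal_elt a /\
     forall J : {set 'I_N}, J \proper [set: 'I_N]%SET -> (2 <= #|J|)%N ->
       nabla_set J a !=set0].

Definition positive_vectors : set 'rV[int]_N := [set a | forall k, 0 < a 0 k].

Definition Gamma : set 'rV[int]_N := GammaHat `&` positive_vectors.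

Definition Lambda : set 'rV[int]_N := LambdaHat `&` positive_vectors.

End GeneralizedWeierstrassSemigroup.

(* An algebraic function field of one variable over K is a finite extension
   of the rational function field K(x) = {fraction {poly K}}. *)
Section FunctionField.
Variable K : fieldType.

Definition ratfun_const : {rmorphism K -> {fraction {poly K}}} :=
  @FracField.tofrac {poly K} \o polyC.

Definition ratfun_X : {fraction {poly K}} := FracField.tofrac 'X.

Variable F : fieldExtType {fraction {poly K}}.

Definition ff_const : {rmorphism K -> F} := in_alg F \o ratfun_const.

(* The valuation ideal of P is contained in the one of P'. *)
Definition lies_over (P' : place ff_const) (P : place ratfun_const) : Prop :=
  forall r : {fraction {poly K}}, 0 < ord P r -> 0 < ord P' r%:A.

Definition lies_over_zero (Q : place ff_const) (gamma : K) : Prop :=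
  exists2 P : place ratfun_const,
    0 < ord P (ratfun_X - ratfun_const gamma) & lies_over Q P.

(* F = K(x, y).  The polynomial Y^(q^n+1) - f(x) is irreducible over K(x)
   (Eisenstein at x - gamma for gamma a root of x^(q+1) - 1, which is a simple
   root of f), so this determines F up to isomorphism. *)
Definition BM_function_field (q n : nat) (y : F) : Prop :=
  let x : F := ratfun_X%:A in
  y ^+ (q ^ n).+1 =
    (x ^+ q.+1 - 1) * x ^+ q.+1
      * (x ^+ (q ^ 2 - 1) - (x ^+ q.+1 - 1) ^+ (q - 1)) ^+ q.+1
  /\ <<1; y>>%VS = fullv.

End FunctionField.

Definition BM_beta (q n i : nat) : int :=
  let M : rat := ((q ^ n).+1)%:R in
  q%:Z + 1 + (q%:Z ^+ 2 - q%:Z - 1) * Num.ceil (i%:R * (q%:R + 1) / M)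
    - Num.floor (i%:R * (q%:R ^+ 3 - q%:R) / M) - 1.

(* Main.v *)
(* Let M' = q^n + 1, let d = x^(q+1) - 1 and let w be x times the last factor, so
   that y^M' = d w^(q+1).  In characteristic p one has d w = x - x^(q^2), which is
   squarefree.  Over a root of d there is a single place; there y is a uniformizer
   and the functions of x have values divisible by M'.  Hence the terms g_i(x) y^i
   (0 <= i < M') of a function z have distinct values at each Q_k, so that the value
   of z is the least of theirs; and z is regular outside Q iff every term is, because
   a term is a combination of the conjugates of z under y |-> zeta y, and these
   conjugations fix every Q_k.  A term with pole orders M' J_k - i at the Q_k can be
   regular elsewhere iff the sum of the J_k reaches a threshold given by the zeros of
   w and the pole of x.  So a vector a lies in the semigroup iff, for each residue c
   modulo M' of one of its entries, the sum over l of floor((a_l - c) / M') is at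
   least a threshold B(c), and maximality becomes combinatorics: an absolute
   (relative) maximal vector has a single residue c, and the sum is B(c)
   (B(c) + N - 2). *)
Require Import Defs.
From HB Require Import structures.
From mathcomp Require Import all_boot all_order all_algebra all_field.
From mathcomp Require Import boolp classical_sets.
From mathcomp Require Import cyclic zify ring lra.

Set Implicit Arguments.
Unset Strict Implicit.
Unset Printing Implicit Defensive.

Import Order.TTheory GRing.Theory Num.Theory.

Local Open Scope classical_set_scope.
Local Open Scope ring_scope.

(** * Extension of places *)

(** The obstacle is the necessity of the threshold. To show that a regular term obeys it, regularity
    must be tested at a zero of any irreducible factor of a denominator and at a pole of x, so
    places of [F] must be shown to exist there. They come from Chevalley's construction: a subring
    maximal among those that contain K[x] (or K[1/x]) and miss the inverse of a given prime is a
    valuation ring. Finiteness of [F] over K(x) makes its values integral once everything is raised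
    to the power [F : K(x)]!. No genus, divisor degree or Riemann-Roch enters. Sufficiency has an
    explicit witness, y^i times powers of the x - alpha_l and of 1/w. The exponent of 1/w is
    floor(i(q+1)/M'), the largest that the zeros of y^i along w can absorb, and the order at a pole
    of x is then read off from degrees: y^M' has degree q^3 - q in x and w has degree q^2 - q - 1.
    Pole orders M' J - i have residue M' - i. The reflection i -> M' - i turns that floor into the
    ceiling of beta, and moving one block of length M' at each of the N places produces the summand
    -N. *)

Section ValuationRing.
Variables (E : fieldType) (A : set E) (t : E).

Definition subring_set (S : set E) :=
  [/\ S 1, forall a b, S a -> S b -> S (a - b)
    & forall a b, S a -> S b -> S (a * b)].

Definition avoiding (S : set E) :=
  [/\ subring_set S, A `<=` S & ~ S t^-1].

Lemma maximal_avoiding : avoiding A ->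
  exists2 B, avoiding B & forall C, avoiding C -> B `<=` C -> C `<=` B.
Proof.
move=> avA.
have [|B [PB maxB]] := @Zorn_bigcup E [set S | S = set0 \/ avoiding S].
  move=> F FP tF.
  have [[S [FS [_ AS _]]]|no] := pselect (exists S, F S /\ avoiding S); last first.
    left; apply/seteqP; split=> // z [S FS Sz].
    case: (FP S FS) => [S0|avS]; first by rewrite S0 in Sz.
    by case: no; exists S.
  have avF a S' : F S' -> S' a -> avoiding S'.
    by move=> /FP[->//|].
  have common a b : (\bigcup_(X in F) X) a -> (\bigcup_(X in F) X) b ->
      exists S', [/\ F S', avoiding S', S' a & S' b].
    move=> [S1 F1 S1a] [S2 F2 S2b].
    case: (tF S1 S2 F1 F2) => sub.
      by exists S2; split => //; [apply: avF F2 S2b|apply: sub].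
    by exists S1; split => //; [apply: avF F1 S1a|apply: sub].
  have [_ [A1 _ _]] : A 1 /\ subring_set A by case: avA => -[].
  right; split; last 1 first.
  - by move=> [S' FS' S't]; case: (avF _ _ FS' S't).
  - split; first by exists S => //; exact: AS.
    + move=> a b Ca Cb; have [S' [FS' [[_ sB _] _ _] Sa Sb]] := common _ _ Ca Cb.
      by exists S' => //; apply: sB.
    + move=> a b Ca Cb; have [S' [FS' [[_ _ sM] _ _] Sa Sb]] := common _ _ Ca Cb.
      by exists S' => //; apply: sM.
  - by move=> a Aa; exists S => //; apply: AS.
have avB : avoiding B.
  case: PB => // B0; exfalso; apply: (maxB A); last by right.
  rewrite B0; split=> // A0; case: avA => -[A1 _ _] _ _.
  by have := A0 1 A1.
exists B => // C avC BC z Cz; apply: contrapT => nBz.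
by apply: (maxB C); [split=> // CB; apply: nBz; apply: CB|right].
Qed.

Variable B : set E.
Hypothesis avB : avoiding B.
Hypothesis maxB : forall C, avoiding C -> B `<=` C -> C `<=` B.
Hypothesis At : A t.

Lemma mv1 : B 1. Proof. by case: avB => -[]. Qed.
Lemma mvB a b : B a -> B b -> B (a - b).
Proof. by case: avB => -[_ h _] _ _; apply: h. Qed.
Lemma mvM a b : B a -> B b -> B (a * b).
Proof. by case: avB => -[_ _ h] _ _; apply: h. Qed.
Lemma mv0 : B 0. Proof. by rewrite -(subrr 1); apply: mvB; apply: mv1. Qed.
Lemma mvN a : B a -> B (- a).
Proof. by rewrite -sub0r; apply: mvB; apply: mv0. Qed.
Lemma mvD a b : B a -> B b -> B (a + b).
Proof. by move=> Ba Bb; rewrite -[b]opprK; apply/mvB/mvN. Qed.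
Lemma mvX a n : B a -> B (a ^+ n).
Proof.
by move=> Ba; elim: n => [|n IH]; [apply: mv1|rewrite exprS; apply: mvM].
Qed.
Lemma mvt : B t. Proof. by case: avB => _ AB _; apply: AB. Qed.
Lemma mv_nt : ~ B t^-1. Proof. by case: avB. Qed.

Lemma mvt_neq0 : t != 0.
Proof. by apply/eqP => t0; apply: mv_nt; rewrite t0 invr0; apply: mv0. Qed.

Lemma mv_1subt_neq0 b : B b -> 1 - t * b != 0.
Proof.
move=> Bb; apply/eqP => e; apply: mv_nt.
suff -> : t^-1 = b by [].
by apply: (mulfI mvt_neq0); rewrite divff ?mvt_neq0 //; apply/eqP; rewrite -subr_eq0 e.
Qed.

(** The fractions with numerator in [B] and denominator a power of [u] form a ring containing [B].
    It still misses [t^-1], because powers of [u] are 1 modulo [t], so by maximality it is [B]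
    itself. *)
Lemma mv_unit b : B b -> B (1 - t * b)^-1.
Proof.
move=> Bb; set u := 1 - t * b.
have u0 : u != 0 by apply: mv_1subt_neq0.
have Bu : B u by apply/mvB/mvM => //; [apply: mv1|apply: mvt].
pose C := [set z | exists s, B (z * u ^+ s)].
apply: (maxB (C := C)); last by exists 1%N; rewrite mulVf //; apply: mv1.
  split.
  - split.
    + by exists 0%N; rewrite mulr1; apply: mv1.
    + move=> a c [s Ba] [s' Bc]; exists (s + s')%N.
      have -> : (a - c) * u ^+ (s + s') = a * u ^+ s * u ^+ s' - c * u ^+ s' * u ^+ s.
        by rewrite exprD; ring.
      by apply: mvB; apply: mvM => //; apply: mvX.
    + move=> a c [s Ba] [s' Bc]; exists (s + s')%N.
      by rewrite exprD mulrACA; apply: mvM.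
  - by move=> a Aa; exists 0%N; rewrite mulr1; case: avB => _ AB _; apply: AB.
  - move=> [s Bs].
    (* modulo t the element u ^ s is 1 *)
    have [c Bc ec] : exists2 c, B c & u ^+ s = 1 - t * c.
      elim: s {Bs} => [|s [c Bc ec]]; first by exists 0; [apply: mv0|rewrite mulr0 subr0].
      exists (b + c - t * (b * c)); last by rewrite exprS ec /u; ring.
      by apply/mvB; [apply: mvD|apply/mvM/mvM => //; apply: mvt].
    apply: mv_nt; have -> : t^-1 = t^-1 * u ^+ s + c.
      by rewrite ec; field; apply: mvt_neq0.
    exact: mvD.
by move=> z Bz; exists 0%N; rewrite mulr1.
Qed.

Definition coefs_in (c : {poly E}) := forall i, B c`_i.

Lemma coefs_inD c d : coefs_in c -> coefs_in d -> coefs_in (c + d).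
Proof. by move=> hc hd i; rewrite coefD; apply: mvD. Qed.

Lemma coefs_inB c d : coefs_in c -> coefs_in d -> coefs_in (c - d).
Proof. by move=> hc hd i; rewrite coefB; apply: mvB. Qed.

Lemma coefs_inM c d : coefs_in c -> coefs_in d -> coefs_in (c * d).
Proof.
move=> hc hd i; rewrite coefM; elim/big_ind: _ => [||j _].
- exact: mv0.
- exact: mvD.
- exact: mvM.
Qed.

Lemma coefs_inC a : B a -> coefs_in a%:P.
Proof. by move=> Ba i; rewrite coefC; case: ifP => // _; apply: mv0. Qed.

Lemma coefs_inXn k : coefs_in 'X^k.
Proof. by move=> i; rewrite coefXn; case: (i == k); [apply: mv1|apply: mv0]. Qed.

(** The ring B[z] is strictly larger than [B], so by maximality it contains [t^-1]. *)
Lemma mv_adjoin z : ~ B z -> exists2 c, coefs_in c & t * c.[z] = 1.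
Proof.
move=> nBz; apply: contrapT => no; apply: nBz.
pose C := [set w | exists2 c, coefs_in c & w = c.[z]].
apply: (maxB (C := C)); last by exists 'X; [apply: (coefs_inXn 1)|rewrite hornerX].
  split.
  - split.
    + by exists 1; [apply: (coefs_inXn 0)|rewrite hornerC].
    + move=> _ _ [a Ba ->] [b Bb ->]; exists (a - b); last by rewrite !hornerE.
      exact: coefs_inB.
    + move=> _ _ [a Ba ->] [b Bb ->]; exists (a * b); last by rewrite !hornerE.
      exact: coefs_inM.
  - move=> a Aa; exists a%:P; last by rewrite hornerC.
    by apply: coefs_inC; case: avB => _ AB _; apply: AB.
  - by move=> [c Bc e]; apply: no; exists c => //; rewrite -e divff // mvt_neq0.
by move=> w Bw; exists w%:P; [apply: coefs_inC|rewrite hornerC].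
Qed.

(** Chevalley's descent: the relation of larger degree can be shortened with the help of the other,
    so a pair of relations of least total size cannot exist. Exchanging z and 1/z lets [c] be the
    longer one. *)
Lemma no_two_relations n (z : E) (c d : {poly E}) : z != 0 -> (size c + size d <= n)%N ->
  coefs_in c -> coefs_in d -> t * c.[z] = 1 -> t * d.[z^-1] = 1 -> False.
Proof.
elim: n z c d => [|n IH] z c d z0 sz Bc Bd ec ed.
  have c0 : c = 0 by apply/eqP; rewrite -size_poly_eq0; lia.
  by move: ec; rewrite c0 horner0 mulr0 => /esym/eqP; rewrite oner_eq0.
wlog le : z c d z0 sz Bc Bd ec ed / (size d <= size c)%N.
  move=> H; have [le|/ltnW le] := leqP (size d) (size c); first exact: (H z c d).
  by apply: (H z^-1 d c) => //; rewrite ?invr_eq0 ?invrK // addnC.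
have d0 : (0 < size d)%N.
  rewrite lt0n size_poly_eq0; apply/eqP => d0.
  by move: ed; rewrite d0 horner0 mulr0 => /esym/eqP; rewrite oner_eq0.
have szc : (0 < size c)%N by lia.
pose b := (size d).-1; pose a := (size c).-1.
(* Moving the constant term of [d] to the other side leaves the unit [u]. Multiplying by z^b / u
   then expresses z^b as t e(z) with [e] of degree below [b] and coefficients in [B]. *)
pose u := 1 - t * d`_0.
have u0 : u != 0 by apply: mv_1subt_neq0.
pose e := \poly_(i < b) (u^-1 * d`_(b - i)).
have Be : coefs_in e.
  move=> i; rewrite coef_poly; case: ifP => _; last exact: mv0.
  by apply: mvM; first by apply: mv_unit.
have ze : z ^+ b = t * e.[z].
  apply: (mulfI u0); rewrite horner_poly mulrCA mulr_sumr.
  have -> : \sum_(i < b) u * (u^-1 * d`_(b - i) * z ^+ i)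
          = z ^+ b * \sum_(i < b) d`_i.+1 * z^-1 ^+ i.+1.
    rewrite (reindex_inj rev_ord_inj) mulr_sumr /=; apply: eq_bigr => i _.
    have -> : (b - (b - i.+1) = i.+1)%N by have := ltn_ord i; lia.
    have -> : z ^+ (b - i.+1) = z ^+ b * z^-1 ^+ i.+1.
      have eb : z ^+ b = z ^+ (b - i.+1) * z ^+ i.+1 by rewrite -exprD subnK.
      by rewrite eb exprVn mulfK // expf_neq0.
    rewrite !mulrA divff // mul1r; ring.
  move: ed; rewrite horner_coef -(prednK d0) big_ord_recl expr0 mulr1 -/b => ed.
  rewrite mulrCA -[X in X * _](mulr1 u) [in RHS]mulrC.
  rewrite /u -{1}ed; ring.
(* The leading term of [c] is rewritten through z^b = t e(z): the value at [z] is kept and the size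
   drops. *)
pose c' := c`_a *: 'X^(a - b) * (t *: e) + \poly_(i < a) c`_i.
have ba : (b <= a)%N by rewrite /a /b; lia.
apply: (IH z c' d) => //.
- suff : (size c' <= a)%N by rewrite /a; lia.
  rewrite (leq_trans (size_polyD _ _)) // geq_max size_poly andbT.
  rewrite -scalerAl (leq_trans (size_scale_leq _ _)) //.
  rewrite -scalerAr (leq_trans (size_scale_leq _ _)) //.
  rewrite mulrC (leq_trans (size_polyMleq _ _)) // size_polyXn addnS /=.
  by rewrite -{2}(subnKC ba) leq_add2r size_poly.
- apply: coefs_inD; last first.
    by move=> i; rewrite coef_poly; case: ifP => _ //; apply: mv0.
  rewrite -!mul_polyC; apply: coefs_inM; apply: coefs_inM => //.
  + exact: coefs_inC.
  + exact: coefs_inXn.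
  + by apply: coefs_inC; apply: mvt.
- rewrite -ec; congr (_ * _).
  rewrite /c' hornerD hornerM !hornerZ hornerXn horner_poly -ze -mulrA -exprD.
  by rewrite subnK // horner_coef -(prednK szc) big_ord_recr /= addrC.
Qed.

Lemma mv_total (z : E) : z != 0 -> ~ B z -> B z^-1.
Proof.
move=> z0 nBz; apply: contrapT => nBz'.
have [c Bc ec] := mv_adjoin nBz.
have [d Bd ed] := mv_adjoin nBz'.
exact: (no_two_relations z0 (leqnn _) Bc Bd ec ed).
Qed.

End ValuationRing.

(** * Units and cancellation in a valuation ring *)

Section ValuationRingUnits.
Variables (E : fieldType) (B : set E).
Hypothesis ringB : subring_set B.
Hypothesis totalB : forall z : E, z != 0 -> ~ B z -> B z^-1.

Let B1 : B 1. Proof. by case: ringB. Qed.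
Let BB a b : B a -> B b -> B (a - b). Proof. by case: ringB => _ h _; apply: h. Qed.
Let BM a b : B a -> B b -> B (a * b). Proof. by case: ringB => _ _; apply. Qed.
Let B0 : B 0. Proof. by rewrite -(subrr 1); apply: BB. Qed.
Let BN a : B a -> B (- a). Proof. by rewrite -sub0r; apply: BB. Qed.
Let BD a b : B a -> B b -> B (a + b).
Proof. by move=> Ba Bb; rewrite -[b]opprK; apply: BB => //; apply: BN. Qed.

Definition vr_unit (z : E) := [/\ z != 0, B z & B z^-1].

Lemma vr_unit1 : vr_unit 1.
Proof. by split; rewrite ?oner_neq0 ?invr1. Qed.

Lemma vr_unitM a b : vr_unit a -> vr_unit b -> vr_unit (a * b).
Proof.
by move=> [a0 Ba Ba'] [b0 Bb Bb']; split; rewrite ?mulf_neq0 ?invfM //; apply: BM.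
Qed.

Lemma vr_unitV a : vr_unit a -> vr_unit a^-1.
Proof. by move=> [a0 Ba Ba']; split; rewrite ?invr_eq0 ?invrK. Qed.

Lemma vr_unitX a n : vr_unit a -> vr_unit (a ^+ n).
Proof.
by move=> ua; elim: n => [|n IH]; [apply: vr_unit1|rewrite exprS; apply: vr_unitM].
Qed.

(** Of two nonzero elements one divides the other in [B]. If b divides a, then a + b is a multiple
    of b, so b is a unit whenever a + b is. *)
Lemma vr_nonunitD a b : ~ vr_unit a -> ~ vr_unit b -> B a -> B b -> ~ vr_unit (a + b).
Proof.
wlog ab : a b / b = 0 \/ B (a / b).
  move=> H na nb Ba Bb.
  have [b0|b0] := eqVneq b 0; first by apply: H => //; left.
  have [a0|a0] := eqVneq a 0; first by rewrite addrC; apply: H => //; left.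
  have [Bab|nBab] := pselect (B (a / b)); first by apply: H => //; right.
  rewrite addrC; apply: H => //; right.
  by rewrite -invf_div; apply: totalB; rewrite ?mulf_neq0 ?invr_eq0.
move=> na nb Ba Bb [ab0 Bab Bab'].
case: ab => [b0|Bq]; first by apply: na; split => //; move: ab0 Bab'; rewrite b0 addr0.
have [b0|b0] := eqVneq b 0; first by apply: na; split => //; move: ab0 Bab'; rewrite b0 addr0.
apply: nb; split=> //.
have -> : b^-1 = (a / b + 1) * (a + b)^-1 by field; rewrite ab0 b0.
by apply: BM => //; apply: BD.
Qed.

Lemma vr_sum_nonunit (I : finType) (P : pred I) (x : I -> E) :
  (forall i, P i -> B (x i) /\ ~ vr_unit (x i)) ->
  B (\sum_(i | P i) x i) /\ ~ vr_unit (\sum_(i | P i) x i).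
Proof.
move=> h; elim/big_ind: _ => //.
  by split=> // -[]; rewrite eqxx.
by move=> a b [Ba na] [Bb nb]; split; [apply: BD|apply: vr_nonunitD].
Qed.

Lemma vr_dominant (I : eqType) (x : I -> E) (i0 : I) (s : seq I) :
  (forall i, i \in i0 :: s -> x i != 0) ->
  exists2 i, i \in i0 :: s & forall j, j \in i0 :: s -> B (x j / x i).
Proof.
elim: s i0 => [|i1 s IH] i0 h.
  exists i0; rewrite ?mem_head // => j; rewrite inE => /eqP ->.
  by rewrite divff // h // mem_head.
have [|i ii hi] := IH i1.
  by move=> i ii; apply: h; rewrite inE ii orbT.
have x0 : x i0 != 0 by rewrite h // mem_head.
have xi : x i != 0 by rewrite h // inE ii orbT.
have [B01|nB01] := pselect (B (x i0 / x i)).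
  exists i; first by rewrite inE ii orbT.
  by move=> j; rewrite inE => /predU1P[->//|]; apply: hi.
exists i0; first by rewrite mem_head.
have Bi : B (x i / x i0).
  by rewrite -invf_div; apply: totalB; rewrite ?mulf_neq0 ?invr_eq0.
move=> j; rewrite inE => /predU1P[->|js]; first by rewrite divff.
have -> : x j / x i0 = x j / x i * (x i / x i0) by field; rewrite x0 xi.
by apply: BM => //; apply: hi.
Qed.

(** Divide by a term of least value. If no other term had that value, the remaining terms would be
    nonunits with a nonunit sum, yet that sum is -1. *)
Lemma vr_cancel (I : finType) (x : I -> E) :
  \sum_i x i = 0 -> (exists i, x i != 0) ->
  exists i j, [/\ i != j, x i != 0, x j != 0 & vr_unit (x i / x j)].
Proof.
move=> sx [i0 xi0].
have [|i ii hi] := @vr_dominant I x i0 (enum [pred i | x i != 0]).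
  by move=> i; rewrite inE mem_enum => /predU1P[->|].
have xi : x i != 0 by move: ii; rewrite inE mem_enum => /predU1P[->|].
apply: contrapT => no.
have [|_] := @vr_sum_nonunit I (predC1 i) (fun j => x j / x i).
  move=> j ji; have [xj|xj] := eqVneq (x j) 0.
    by rewrite xj mul0r; split=> // -[]; rewrite eqxx.
  split; first by apply: hi; rewrite inE mem_enum inE xj orbT.
  by move=> u; apply: no; exists j, i.
apply; rewrite -mulr_suml.
have -> : \sum_(j | j != i) x j = - x i.
  by apply: (addrI (x i)); rewrite subrr -[RHS]sx [RHS](bigD1 i).
rewrite mulNr divff //; split; rewrite ?oppr_eq0 ?oner_neq0 ?invrN ?invr1 //.
  exact: BN.
exact: BN.
Qed.

End ValuationRingUnits.

(** * Normalising an integer-valued valuation *)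

Section PlaceOfValuation.
Variables (K E : fieldType) (iota : {rmorphism K -> E}) (w : E -> int).
Hypothesis wM : forall a b : E, a != 0 -> b != 0 -> w (a * b) = w a + w b.
Hypothesis wD : forall a b : E, a != 0 -> b != 0 -> a + b != 0 ->
  Num.min (w a) (w b) <= w (a + b).
Hypothesis wC : forall c : K, c != 0 -> w (iota c) = 0.

(** The values of [w] form a nonzero subgroup of the integers, generated by the least positive value
    [g]; dividing by [g] makes the valuation surjective. *)
Lemma place_of_valuation (t : E) : t != 0 -> 0 < w t ->
  exists P : place iota, exists2 g : int, 0 < g & forall z : E, z != 0 -> w z = g * ord P z.
Proof.
move=> t0 wt.
have w1 : w 1 = 0 by apply: (addrI (w 1)); rewrite -wM ?oner_neq0 // mulr1 addr0.
have wV a : a != 0 -> w a^-1 = - w a.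
  by move=> a0; apply: (addrI (w a)); rewrite -wM ?invr_eq0 // divff // subrr.
have wX a n : a != 0 -> w (a ^+ n) = n%:Z * w a.
  move=> a0; elim: n => [|n IH]; first by rewrite w1 mul0r.
  by rewrite exprS wM ?expf_neq0 // IH; lia.
have wXz a (k : int) : a != 0 -> w (a ^ k) = k * w a.
  move=> a0; case: k => n; first by rewrite -exprnP wX.
  by rewrite NegzE -exprnN wV ?expf_neq0 // wX //; lia.
have ex : exists n, `[< (0 < n)%N /\ exists2 z, z != 0 & w z = n%:Z >].
  by exists `|w t|%N; apply/asboolP; split; [lia|exists t => //; lia].
pose g := ex_minn ex.
have [g0 [u u0 wu] gmin] : [/\ (0 < g)%N, exists2 z, z != 0 & w z = g%:Z &
   forall n z, (0 < n)%N -> z != 0 -> w z = n%:Z -> (g <= n)%N].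
  rewrite /g; case: ex_minnP => m /asboolP[m0 hm] hmin; split=> // n z n0 z0 wz.
  by apply: hmin; apply/asboolP; split=> //; exists z.
have gdvd z : z != 0 -> w z = g%:Z * (w z %/ g%:Z)%Z.
  move=> z0; have e := divz_eq (w z) g%:Z.
  have r0 : 0 <= (w z %% g%:Z)%Z by apply: modz_ge0; lia.
  have rg : (w z %% g%:Z)%Z < g%:Z by apply: ltz_pmod.
  suff : (w z %% g%:Z)%Z = 0 by move=> r; rewrite {1}e r addr0 mulrC.
  apply: contrapT => rn0.
  have := gmin `|(w z %% g%:Z)%Z|%N (z * u ^ (- (w z %/ g%:Z)%Z)).
  rewrite mulf_neq0 ?expfz_neq0 // wM ?expfz_neq0 // wXz // wu.
  by move=> /(_ ltac:(lia) isT ltac:(lia)); lia.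
pose o z := if z == 0 then 0 else (w z %/ g%:Z)%Z.
have wo z : z != 0 -> w z = g%:Z * o z by move=> z0; rewrite /o (negbTE z0); apply: gdvd.
have gp : 0 < g%:Z by rewrite ltz_nat.
have gz : g%:Z != 0 by rewrite gt_eqF.
have o0 : o 0 = 0 by rewrite /o eqxx.
have oM a b : a != 0 -> b != 0 -> o (a * b) = o a + o b.
  move=> a0 b0; apply: (mulfI gz).
  by rewrite -wo ?mulf_neq0 // wM // mulrDr -!wo.
have oD a b : a != 0 -> b != 0 -> a + b != 0 -> Num.min (o a) (o b) <= o (a + b).
  move=> a0 b0 ab0; have := wD a0 b0 ab0; rewrite !wo //.
  by rewrite -minr_pMr ?(ler_pM2l gp) ?(ltW gp).
have oC c : c != 0 -> o (iota c) = 0.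
  move=> c0; apply: (mulfI gz); rewrite -wo ?fmorph_eq0 // mulr0; exact: wC.
have oS : exists t, o t = 1.
  by exists u; apply: (mulfI gz); rewrite -wo // mulr1.
by exists (Place o0 oM oD oC oS), g%:Z.
Qed.

End PlaceOfValuation.

Lemma irreducible_split (K : fieldType) (p a : {poly K}) :
  irreducible_poly p -> a != 0 -> exists s, exists2 a', a = p ^+ s * a' & ~~ (p %| a').
Proof.
move=> irp; have [n] := ubnP (size a); elim: n a => // n IH a sz a0.
have [dv|ndv] := boolP (p %| a); last by exists 0%N, a; rewrite ?mul1r.
have ea : a = (a %/ p) * p by rewrite divpK.
have q0 : a %/ p != 0 by apply: contraNneq a0 => q0; rewrite ea q0 mul0r.
have [||s [a' e na']] := IH (a %/ p) => //.
  apply: (@leq_trans (size a)); last by rewrite -ltnS.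
  rewrite size_divp ?irredp_neq0 //.
  have [p1 _] := irp; have : (0 < size a)%N by rewrite size_poly_gt0.
  by case: (size a) (size p) p1 => [|m] [|[|l]] //= _ _; rewrite subSS ltnS leq_subr.
by exists s.+1, a' => //; rewrite ea e exprSr mulrAC.
Qed.

(** * Existence of a place at a prime of a polynomial subring *)

Section PlaceExistence.
Variables (K k : fieldType) (F : fieldExtType k).
Variables (iota : {rmorphism K -> F}) (pe : {rmorphism {poly K} -> F}).
Hypothesis peC : forall c, pe c%:P = iota c.
Hypothesis fracE : forall r : k, exists a b, pe b != 0 /\ r%:A = pe a / pe b.
Variable p : {poly K}.
Hypothesis irp : irreducible_poly p.
Hypothesis pep0 : pe p != 0.
Hypothesis pep_nunit : forall a, pe a * pe p != 1.

(** The map [pe] is abstract so that it can be evaluation at x or at 1/x: finite places and places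
    at infinity come from one construction. [pep_nunit] says that the image of [pe] itself avoids
    the inverse of [pe p], which starts the maximality argument. *)
Theorem place_exists : exists P : place iota, 0 < ord P (pe p) /\ 0 <= ord P (pe 'X).
Proof.
set t := pe p; pose A := range pe.
have At : A t by exists p.
have ringA : subring_set A.
  split; first by exists 1; rewrite ?rmorph1.
    by move=> _ _ [a _ <-] [b _ <-]; exists (a - b); rewrite ?rmorphB.
  by move=> _ _ [a _ <-] [b _ <-]; exists (a * b); rewrite ?rmorphM.
have avA : avoiding A t A.
  split=> // -[a _ ea].
  by have := pep_nunit a; rewrite ea mulVf // eqxx.
have [B avB maxB] := maximal_avoiding avA.
have [ringB AB nBt] := avB.
have totB : forall z : F, z != 0 -> ~ B z -> B z^-1.
  by move=> z; apply: mv_total avB maxB At z.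
have [B1 BB BM] := ringB.
have B0 : B 0 by rewrite -(subrr 1); apply: BB.
have BX a n : B a -> B (a ^+ n).
  by move=> Ba; elim: n => [|n IH]; rewrite ?expr0 // exprS; apply: BM.
have Bpe a : B (pe a) by apply: AB; exists a.
pose unit := vr_unit B.
have uM a b : unit a -> unit b -> unit (a * b) := vr_unitM ringB (b := b).
have uV a : unit a -> unit a^-1 := @vr_unitV _ B a.
have uX a n : unit a -> unit (a ^+ n) := vr_unitX ringB n.
(* By Bezout, some multiple of [pe a] has the form 1 - t b with b in [B], and such elements are
   units. *)
have upe a : ~~ (p %| a) -> unit (pe a).
  rewrite -irreducible_poly_coprime // => /Bezout_eq1_coprimepP[[c d] /= e].
  have e' : pe a * pe d = 1 - t * pe c by rewrite -rmorphM mulrC -(rmorph1 pe) -e rmorphD rmorphM -/t; ring.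
  have u0 : 1 - t * pe c != 0 by apply: (mv_1subt_neq0 avB).
  have a0 : pe a != 0 by apply: contraNneq u0 => a0; rewrite -e' a0 mul0r.
  split=> //; have -> : (pe a)^-1 = pe d * (1 - t * pe c)^-1.
    by rewrite -e' invfM mulrA mulrAC divff ?mul1r //; move: u0; rewrite -e' mulf_eq0 negb_or => /andP[].
  by apply: BM => //; apply: (mv_unit avB maxB At).
have tpe a : pe a != 0 -> exists s : int, unit (pe a * t ^ s).
  move=> a0; have [|s [a' ea na']] := @irreducible_split _ p a irp.
    by apply: contraNneq a0 => ->; rewrite rmorph0.
  exists (- s%:Z); rewrite ea rmorphM rmorphXn -exprnN mulrAC divff ?expf_neq0 // mul1r.
  exact: upe.
have tz (a b : int) : t ^ (a + b) = t ^ a * t ^ b by rewrite expfzDr.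
have tk (r : k) : r != 0 -> exists s : int, unit (r%:A * t ^ s).
  have [a [b [b0 er]]] := fracE r.
  move=> r0; have a0 : pe a != 0.
    apply: contraNneq r0 => a0; move/eqP: er.
    by rewrite a0 mul0r scaler_eq0 oner_eq0 orbF.
  have [s us] := tpe _ a0; have [s' us'] := tpe _ b0.
  exists (s - s'); rewrite er tz -invr_expz.
  have -> : pe a / pe b * (t ^ s * (t ^ s')^-1) = (pe a * t ^ s) * (pe b * t ^ s')^-1.
    by rewrite invfM; ring.
  by apply: uM => //; apply: uV.
pose n := \dim {:F}.
(* In the relation given by the minimal polynomial of [z] two nonzero terms have the same value.
   Their coefficients lie in [k], where values are powers of [t], so a power of [z] with exponent at
   most [F : k] is a unit times a power of [t]. *)
have zpow (z : F) : z != 0 -> exists e, exists2 s : int, (0 < e <= n)%N & unit (z ^+ e * t ^ s).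
  move=> z0; pose M := minPoly 1%AS z.
  have /polyOver1P[m em] : M \is a polyOver 1%VS by apply: minPolyOver.
  have mi (i : nat) : M`_i = (m`_i)%:A by rewrite em coef_map.
  have szM : (size M <= n.+1)%N.
    rewrite size_minPoly ltnS /n adjoin_degreeE dimv1 divn1.
    exact: dimvS (subvf _).
  have [||i [j [ij xi xj uij]]] := @vr_cancel _ B ringB totB 'I_(size M) (fun i => M`_i * z ^+ i).
  - by rewrite -horner_coef; apply/eqP; have := root_minPoly 1%AS z.
  - have sM : (0 < size M)%N by rewrite size_minPoly.
    exists (Ordinal (ltac:(lia) : ((size M).-1 < size M)%N)) => /=.
    by rewrite mulf_neq0 ?expf_neq0 // -lead_coefE (eqP (monic_minPoly _ _)) oner_eq0.
  have {ij xi xj uij} [i' [j' [ij xi xj uij]]] : exists i j : 'I_(size M),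
      [/\ (j < i)%N, M`_i != 0, M`_j != 0 & unit ((M`_i * z ^+ i) / (M`_j * z ^+ j))].
    have := ij; rewrite neq_ltn => /orP[lt|lt].
      exists j, i; split=> //; try by move: xi xj; rewrite !mulf_eq0 !negb_or => /andP[? _] /andP[].
      by rewrite -invf_div; apply: uV.
    by exists i, j; split=> //; move: xi xj; rewrite !mulf_eq0 !negb_or => /andP[? _] /andP[].
  have [|s us] := tk (m`_i' / m`_j').
    by move: xi xj; rewrite !mi !scaler_eq0 oner_eq0 !orbF => ? ?; rewrite mulf_neq0 ?invr_eq0.
  exists (i' - j')%N, (- s).
    have := ltn_ord i'; lia.
  have -> : z ^+ (i' - j') * t ^ (- s) =
      ((M`_i' * z ^+ i') / (M`_j' * z ^+ j')) / ((m`_i' / m`_j')%:A * t ^ s).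
    have -> : z ^+ i' = z ^+ (i' - j') * z ^+ j' by rewrite -exprD subnK // ltnW.
    rewrite -invr_expz.
    have -> : (m`_i' / m`_j')%:A = (m`_i')%:A / (m`_j')%:A :> F.
      by rewrite -!in_algE rmorphM fmorphV.
    rewrite -!mi; field; rewrite xi xj expf_neq0 // expfz_neq0 //.
  by apply: uM => //; apply: uV.
(* All exponents [e] found above divide n!, so the single exponent [D] works for every [z]; [w z] is
   the exponent of [t] in z^D up to a unit. *)
pose D := n`!.
have D0 : (0 < D)%N by apply: fact_gt0.
have [w hw] : exists w : F -> int, forall z, z != 0 -> unit (z ^+ D * t ^ (- w z)).
  suff /(@boolp.choice F int)[w hw] : forall z : F, exists s : int, z != 0 -> unit (z ^+ D * t ^ (- s)).
    by exists w.
  move=> z; have [z0|z0] := eqVneq z 0; first by exists 0.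
  have [e [s /andP[e0 en] us]] := zpow z z0.
  have /dvdnP[c Dc] : (e %| D)%N by apply: dvdn_fact; rewrite e0.
  exists (- (s * c%:Z)) => _; rewrite opprK Dc mulnC exprM -exprz_exp -exprnP -exprMn.
  exact: uX.
have Bt (n' : nat) : B (t ^+ n') by apply: BX; apply: Bpe.
have Btz (s : int) : B (t ^ s) -> 0 <= s.
  case: s => // s; rewrite NegzE -exprnN => Bts; exfalso; apply: nBt.
  have -> : t^-1 = t ^- s.+1 * t ^+ s by rewrite exprSr; field; rewrite pep0 expf_neq0.
  exact: BM.
have utz (s : int) : unit (t ^ s) -> s = 0.
  by move=> [_ /Btz s0]; rewrite invr_expz => /Btz s1; lia.
have tz0 (s : int) : t ^ s != 0 by rewrite expfz_neq0.
have wM (a b : F) : a != 0 -> b != 0 -> w (a * b) = w a + w b.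
  move=> a0 b0; apply/eqP; rewrite -subr_eq0; apply/eqP/utz.
  have -> : t ^ (w (a * b) - (w a + w b)) =
      (a ^+ D * t ^ (- w a)) * (b ^+ D * t ^ (- w b)) / ((a * b) ^+ D * t ^ (- w (a * b))).
    rewrite opprD !tz -!invr_expz exprMn; field.
    by rewrite !tz0 !expf_neq0.
  by apply: (uM); [apply: (uM)|apply: uV]; apply: hw; rewrite ?mulf_neq0.
have wB (a : F) : a != 0 -> B a <-> 0 <= w a.
  move=> a0; have [_ B1' B2'] := hw a a0; split.
    move=> Ba; apply: Btz; have -> : t ^ w a = a ^+ D * (a ^+ D * t ^ (- w a))^-1.
      by rewrite -invr_expz; field; rewrite tz0 expf_neq0.
    by apply: BM => //; apply: BX.
  (* [B] is closed under D-th roots: if [a] is outside [B], then its inverse is inside, and a = a^D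
     (1/a)^(D-1). *)
  move=> wa; apply: contrapT => nBa.
  have BaD : B (a ^+ D).
    have -> : a ^+ D = (a ^+ D * t ^ (- w a)) * t ^ w a.
      by rewrite -invr_expz; field; rewrite tz0.
    by apply: BM => //; case: (w a) wa => // n' _; apply: Bt.
  have Ba' := totB a a0 nBa; apply: nBa.
  have -> : a = a ^+ D * a^-1 ^+ D.-1.
    by rewrite -{1}(prednK D0) exprS exprVn mulfK // expf_neq0.
  by apply: BM => //; apply: BX.
have wV (a : F) : a != 0 -> w a^-1 = - w a.
  have w1 : w 1 = 0 by apply: (addrI (w 1)); rewrite -wM ?oner_neq0 // mulr1 addr0.
  by move=> a0; apply: (addrI (w a)); rewrite -wM ?invr_eq0 // divff // subrr.
have wD (a b : F) : a != 0 -> b != 0 -> a + b != 0 -> Num.min (w a) (w b) <= w (a + b).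
  wlog le : a b / w b <= w a.
    move=> H a0 b0 ab0; case: (boolP (w b <= w a)) => [le|]; first exact: H.
    by rewrite -ltNge => /ltW le; rewrite minC addrC; apply: H => //; rewrite addrC.
  move=> a0 b0 ab0; rewrite minElt ltNge le /=.
  have q0 : (a + b) / b != 0 by rewrite mulf_neq0 ?invr_eq0.
  have : 0 <= w ((a + b) / b).
    apply/(wB _ q0); have -> : (a + b) / b = a / b - (- 1) by field.
    apply: (BB); last by rewrite -sub0r; apply: BB.
    apply/wB; first by rewrite mulf_neq0 ?invr_eq0.
    by rewrite wM ?invr_eq0 // wV // subr_ge0.
  by rewrite wM ?invr_eq0 // wV // subr_ge0.
have wC (c : K) : c != 0 -> w (iota c) = 0.
  move=> c0; have ic0 : iota c != 0 by rewrite fmorph_eq0.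
  have h : 0 <= w (iota c) by apply/wB => //; rewrite -peC.
  have : 0 <= w (iota c)^-1 by apply/wB; rewrite ?invr_eq0 // -fmorphV -peC.
  by rewrite wV // oppr_ge0 => h'; apply/eqP; rewrite eq_le h h'.
have wt : 0 < w t.
  rewrite ltNge -oppr_ge0 -wV //; apply/negP => /wB; rewrite invr_eq0 => /(_ pep0).
  exact: nBt.
have [P [g g0 hP]] := place_of_valuation wM wD wC pep0 wt.
exists P; split; first by have := wt; rewrite hP // pmulr_rgt0.
have [X0|X0] := eqVneq (pe 'X) 0; first by rewrite X0 Defs.ord0.
by rewrite -(pmulr_rge0 _ g0) -hP //; apply/wB.
Qed.
End PlaceExistence.

(** * Maximal elements from residue classes *)

Section MaximalElements.
Variables (K E : fieldType) (iota : {rmorphism K -> E}).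
Variables (N : nat) (Q : 'I_N -> place iota) (m : nat) (thr : int -> int).
Hypothesis m_gt0 : (0 < m)%N.
Hypothesis N_ge2 : (2 <= N)%N.

Definition residue (a : 'rV[int]_N) (k : 'I_N) : int := (a 0%R k %% m%:Z)%Z.
(** With [q_l] the l-th summand, m q_l + c is the largest integer up to [a 0 l] that is congruent to
    [c]. The level thus measures the largest pole orders of residue [c] that fit below [a]. *)
Definition level (a : 'rV[int]_N) (c : int) : int :=
  \sum_l ((a 0%R l - c) %/ m%:Z)%Z.

Hypothesis HhatE : forall a : 'rV[int]_N,
  Hhat Q a <-> forall k, thr (residue a k) <= level a (residue a k).

Implicit Types (a : 'rV[int]_N) (J : {set 'I_N}).

Let mz_gt0 : 0 < m%:Z. Proof. by rewrite ltz_nat. Qed.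
Let mz0 : m%:Z != 0. Proof. by rewrite gt_eqF. Qed.

Lemma residue_bounds a k : 0 <= residue a k < m%:Z.
Proof. by rewrite modz_ge0 // ltz_pmod. Qed.

(** These are the indices outside [J] where lowering the entry by 1 lowers the level for the residue
    of [k]. *)
Definition twins a J k : {set 'I_N} := [set l in ~: J | residue a l == residue a k].

Lemma divz_pred_residue a k l :
  ((a 0%R l - 1 - residue a k) %/ m%:Z)%Z
    = ((a 0%R l - residue a k) %/ m%:Z)%Z - (residue a l == residue a k)%:Z.
Proof.
have /andP[k0 km] := residue_bounds a k; have /andP[l0 lm] := residue_bounds a l.
have e := divz_eq (a 0 l) m%:Z; rewrite -/(residue a l) in e.
set q := (a 0%R l %/ m%:Z)%Z in e.
have dv d r : 0 <= r -> r < m%:Z -> ((d * m%:Z + r) %/ m%:Z)%Z = d.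
  by move=> r0 rm; rewrite divzMDl // divz_small ?addr0 // r0 rm.
have [lk|nlk] := eqVneq (residue a l) (residue a k).
  have -> : a 0 l - 1 - residue a k = (q - 1) * m%:Z + (m%:Z - 1) by rewrite e lk; ring.
  have -> : a 0 l - residue a k = q * m%:Z + 0 by rewrite e lk; ring.
  by rewrite !dv //; lia.
rewrite subr0; have [lt|le] := ltP (residue a l) (residue a k).
  have -> : a 0 l - 1 - residue a k = (q - 1) * m%:Z + (m%:Z + residue a l - residue a k - 1).
    by rewrite e; ring.
  have -> : a 0 l - residue a k = (q - 1) * m%:Z + (m%:Z + residue a l - residue a k).
    by rewrite e; ring.
  by rewrite !dv //; lia.
have -> : a 0 l - 1 - residue a k = q * m%:Z + (residue a l - residue a k - 1).
  by rewrite e; ring.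
have -> : a 0 l - residue a k = q * m%:Z + (residue a l - residue a k) by rewrite e; ring.
by rewrite !dv //; lia.
Qed.

(** Vectors of [nabla_set Q J a] lie below [a] with its entries outside [J] lowered by 1; this is
    the level of that bound. *)
Lemma level_outside a J k :
  \sum_l ((a 0%R l - (l \notin J)%:Z - residue a k) %/ m%:Z)%Z
    = level a (residue a k) - #|twins a J k|%:Z.
Proof.
have -> : #|twins a J k|%:Z = \sum_l (l \in twins a J k)%:Z.
  rewrite -sum1_card big_mkcond /= (big_morph Posz PoszD (erefl 0%:Z)).
  by apply: eq_bigr => l _; case: ifP.
rewrite /level -sumrB.
apply: eq_bigr => l _; rewrite !inE; case: (l \in J) => /=; first by rewrite !subr0.
by rewrite divz_pred_residue; case: eqP.
Qed.

Lemma nabla_setP a J j0 : j0 \in J ->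
  nabla_set Q J a !=set0 <->
  forall j, j \in J -> thr (residue a j) + #|twins a J j|%:Z <= level a (residue a j).
Proof.
move=> j0J; split=> [[b [/HhatE hb bJ bnJ]] j jJ|h].
  have rb : residue b j = residue a j by rewrite /residue bJ.
  rewrite -lerBrDr -level_outside.
  rewrite -rb; apply: le_trans (hb j) _; rewrite rb.
  apply: ler_sum => l _; apply: lez_pdiv2r => //; rewrite lerD2r.
  by case: (boolP (l \in J)) => lJ /=; [rewrite bJ ?subr0|have := bnJ l lJ; lia].
(* [f l j] is the largest integer below [a 0 l] with the residue of [a 0 j]. Choosing outside [J]
   the largest of these over [j] in [J] introduces no new residue, so membership of [b] is tested
   only at residues from [J], and there its levels reach the bound of [level_outside]. *)
pose f (l j : 'I_N) : int :=
  ((a 0%R l - 1 - residue a j) %/ m%:Z)%Z * m%:Z + residue a j.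
pose top l := [arg max_(j > j0 | j \in J) f l j]%O.
have topP l : top l \in J /\ forall j, j \in J -> f l j <= f l (top l).
  by rewrite /top; case: arg_maxP => // j jJ hj; split.
pose b : 'rV[int]_N := \row_l if l \in J then a 0 l else f l (top l).
have rb k : exists2 j, j \in J & residue b k = residue a j.
  rewrite /residue mxE; case: ifP => kJ; first by exists k.
  exists (top k); first by case: (topP k).
  by rewrite modzMDl modz_small // residue_bounds.
exists b; split.
- apply/HhatE => k; have [j jJ ->] := rb k.
  apply: le_trans (_ : level a (residue a j) - #|twins a J j|%:Z <= _).
    by rewrite lerBrDr h.
  rewrite -level_outside; apply: ler_sum => l _; rewrite mxE.
  case: (boolP (l \in J)) => lJ /=; first by rewrite subr0.
  rewrite lez_divRL // lerBrDr.
  by case: (topP l) => _ /(_ j jJ).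
- by move=> j jJ; rewrite mxE jJ.
- move=> l lJ; rewrite mxE (negbTE lJ) /f.
  have := divz_eq (a 0 l - 1 - residue a (top l)) m%:Z.
  have := modz_ge0 (a 0 l - 1 - residue a (top l)) mz0.
  lia.
Qed.

Lemma nabla_set_empty a J j0 : j0 \in J ->
  nabla_set Q J a = set0 <->
  exists2 j, j \in J & level a (residue a j) < thr (residue a j) + #|twins a J j|%:Z.
Proof.
move=> j0J; split=> [e|[j jJ lt]].
  apply: contrapT => no; suff : nabla_set Q J a !=set0 by rewrite e => -[].
  apply/(nabla_setP _ j0J) => j jJ; rewrite leNgt; apply/negP => lt.
  by apply: no; exists j.
apply: contrapT => /eqP/set0P/(nabla_setP _ j0J)/(_ j jJ).
by rewrite leNgt lt.
Qed.

Lemma twins_const a J c : (forall k, residue a k = c) -> forall k, twins a J k = ~: J.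
Proof. by move=> hc k; apply/setP => l; rewrite !inE !hc eqxx andbT. Qed.

Lemma level_const a c : (forall k, residue a k = c) ->
  level a c = \sum_k (a 0%R k %/ m%:Z)%Z.
Proof.
move=> hc; apply: eq_bigr => k _.
rewrite -(hc k) {1}(divz_eq (a 0 k) m%:Z) -/(residue a k) addrK.
by rewrite mulzK.
Qed.

Lemma maximal_eltP a : maximal_elt Q a <->
  forall k, thr (residue a k) <= level a (residue a k)
            < thr (residue a k) + #|twins a [set k]%SET k|%:Z.
Proof.
split=> [[/HhatE H nab] k|h].
  rewrite H /=; have [j] : exists2 j, j \in [set k]%SET &
     level a (residue a j) < thr (residue a j) + #|twins a [set k]%SET j|%:Z.
    apply/(nabla_set_empty _ (set11 k)).
    rewrite -subset0 => b nb; have : nabla Q a b by exists k.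
    by rewrite nab.
  by rewrite inE => /eqP ->.
split; first by apply/HhatE => k; case/andP: (h k).
rewrite -subset0 => b [k _ nb].
have : nabla_set Q [set k]%SET a = set0.
  by apply/(nabla_set_empty _ (set11 k)); exists k; rewrite ?set11 //; case/andP: (h k).
by move=> e; move: nb; rewrite e.
Qed.

Let i0 : 'I_N := Ordinal (ltnW N_ge2).

Lemma properT_card J : (J \proper [set: 'I_N]%SET) = (#|J| < N)%N.
Proof.
rewrite properT; apply/idP/idP => h.
  by rewrite -[X in (_ < X)%N]card_ord -cardsT; apply: proper_card; rewrite properT.
by apply: contraTneq h => ->; rewrite cardsT card_ord ltnn.
Qed.

Lemma cardsC_ord J : #|~: J| = (N - #|J|)%N.
Proof. by rewrite cardsCs finset.setCK card_ord. Qed.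

Theorem GammaHatP a : GammaHat Q a <->
  exists2 c, forall k, residue a k = c & level a c = thr c.
Proof.
split=> [[maxa emp]|[c hc lc]].
  pose C := [set l | residue a l == residue a i0]%SET.
  (* Singletons, covered by maximality, and larger sets, covered by absolute maximality, are treated
     together. *)
  have nab J j0 : j0 \in J -> J \proper [set: 'I_N]%SET -> exists2 j, j \in J &
      level a (residue a j) < thr (residue a j) + #|twins a J j|%:Z.
    move=> j0J Jp; apply/(nabla_set_empty _ j0J).
    have [J2|J1] := leqP 2 #|J|; first exact: emp.
    have -> : J = [set j0]%SET.
      by apply/eqP; rewrite eq_sym eqEcard finset.sub1set j0J cards1 -ltnS.
    by rewrite -subset0 => b nb; case: maxa => _ <-; exists j0.
  (* A residue class has no twins outside itself. If it were proper, emptiness of its nabla set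
     would put a level below its threshold, against membership in the semigroup. *)
  have CT : C = [set: 'I_N]%SET.
    apply: contrapT => /eqP nT.
    have [||j jC] := nab C i0; rewrite ?inE ?properT //.
    have -> : twins a C j = finset.set0.
      apply/setP => l; rewrite !inE; move: jC; rewrite inE => /eqP ->.
      by case: eqP.
    rewrite cards0 addr0 ltNge; have /maximal_eltP/(_ j)/andP[-> _] := maxa.
    by [].
  have hc k : residue a k = residue a i0.
    by apply/eqP; have := finset.in_setT k; rewrite -CT inE.
  exists (residue a i0) => //; apply/eqP; rewrite eq_le.
  have /maximal_eltP/(_ i0)/andP[-> _] := maxa; rewrite andbT.
  (* Removing a single index leaves one twin, which forces the level below the threshold plus 1. *)
  have cC : #|~: [set i0]%SET| = N.-1 by rewrite cardsC_ord cards1 subn1.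
  have [||j jC] := nab (~: [set i0]%SET) (Ordinal N_ge2).
  - by rewrite !inE.
  - by rewrite properT_card cC; lia.
  - by rewrite (twins_const _ hc) finset.setCK cards1 hc; lia.
have nab J j0 : j0 \in J -> J \proper [set: 'I_N]%SET -> nabla_set Q J a = set0.
  move=> j0J; rewrite properT_card => Jp; apply/(nabla_set_empty _ j0J); exists j0 => //.
  by rewrite (twins_const _ hc) hc lc cardsC_ord; lia.
split; last first.
  move=> J Jp J2; have [j0 j0J] : exists j0, j0 \in J by apply/card_gt0P; apply: ltnW.
  exact: nab j0J Jp.
apply/maximal_eltP => k; rewrite (twins_const _ hc) hc lc cardsC_ord cards1; lia.
Qed.

Theorem LambdaHatP a : LambdaHat Q a <->
  exists2 c, forall k, residue a k = c & level a c = thr c + (N%:Z - 2).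
Proof.
split=> [[maxa ne]|[c hc lc]].
  pose C := [set l | residue a l == residue a i0]%SET.
  have i0C : i0 \in C by rewrite inE.
  have Ctw : #|C| = (#|twins a [set i0]%SET i0|).+1.
    have -> : C = i0 |: twins a [set i0]%SET i0.
      by apply/setP => l; rewrite !inE; case: (eqVneq l _) => [->|//]; rewrite eqxx.
    by rewrite cardsU1 !inE eqxx.
  have /maximal_eltP/(_ i0)/andP[lo hi] := maxa.
  (* The bounds [lo] and [hi] force [i0] to have a twin. So if some [l] lies outside [C], then N is
     at least 3 and the pair of [i0] and [l] is proper; this pair leaves [i0] as many twins as
     before, and [hi] makes its nabla set empty. *)
  have CT : C = [set: 'I_N]%SET.
    apply: contrapT => /eqP; rewrite -finset.subTset => /fintype.subsetPn[l _ lC].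
    have li : l != i0 by apply: contraNneq lC => ->.
    have cJ : #|[set i0; l]%SET| = 2 by rewrite cards2 eq_sym li.
    have i0J : i0 \in [set i0; l]%SET by rewrite !inE eqxx.
    have CN : (#|C| < N)%N.
      rewrite -properT_card properT; apply: contraNneq lC => ->; by rewrite inE.
    have Jp : [set i0; l]%SET \proper [set: 'I_N]%SET.
      by rewrite properT_card cJ; lia.
    have /(nabla_setP _ i0J)/(_ i0 i0J) := ne _ Jp (eq_leq (esym cJ)).
    have -> : twins a [set i0; l]%SET i0 = twins a [set i0]%SET i0.
      apply/setP => h; rewrite !inE; case: (eqVneq h l) => [->|]; last by rewrite orbF.
      by move: lC; rewrite inE => /negbTE ->; rewrite !andbF.
    lia.
  have hc k : residue a k = residue a i0.
    by apply/eqP; have := finset.in_setT k; rewrite -CT inE.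
  exists (residue a i0) => //.
  move: Ctw; rewrite CT cardsT card_ord => NC.
  (* For N = 2 no proper [J] has two elements, and [lo] and [hi] already fix the level. Otherwise a
     pair leaves N - 2 twins and gives the lower bound, while [hi] gives the upper one. *)
  have [N2|N3] := leqP N 2; first lia.
  pose J := [set i0; Ordinal N_ge2]%SET.
  have cJ : #|J| = 2 by rewrite cards2.
  have i0J : i0 \in J by rewrite !inE eqxx.
  have Jp : J \proper [set: 'I_N]%SET by rewrite properT_card cJ.
  have /(nabla_setP _ i0J)/(_ i0 i0J) := ne _ Jp (eq_leq (esym cJ)).
  by rewrite (twins_const _ hc) cardsC_ord cJ; lia.
split; first by apply/maximal_eltP => k; rewrite (twins_const _ hc) hc lc cardsC_ord cards1; lia.
move=> J Jp J2; have [j0 j0J] : exists j0, j0 \in J by apply/card_gt0P; apply: ltnW.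
by apply/(nabla_setP _ j0J) => j _; rewrite (twins_const _ hc) hc lc cardsC_ord; lia.
Qed.

End MaximalElements.

(** * Places of function fields *)

Section PlaceTheory.
Variables (K E : fieldType) (iota : {rmorphism K -> E}) (P : place iota).

Lemma ord1 : ord P 1 = 0.
Proof. by apply: (addrI (ord P 1)); rewrite -ordM ?oner_neq0 // mulr1 addr0. Qed.

Lemma ordV a : a != 0 -> ord P a^-1 = - ord P a.
Proof.
by move=> a0; apply: (addrI (ord P a)); rewrite -ordM ?invr_eq0 // divff // ord1 subrr.
Qed.

Lemma ordX a s : a != 0 -> ord P (a ^+ s) = s%:Z * ord P a.
Proof.
move=> a0; elim: s => [|s IH]; first by rewrite expr0 ord1 mul0r.
by rewrite exprS ordM ?expf_neq0 // IH intS mulrDl mul1r.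
Qed.

Lemma ordXz a (s : int) : a != 0 -> ord P (a ^ s) = s * ord P a.
Proof.
move=> a0; case: s => s; first exact: ordX.
by rewrite NegzE -exprnN ordV ?expf_neq0 // ordX // mulNr.
Qed.

Lemma ord_prod (I : finType) (a : I -> E) : (forall i, a i != 0) ->
  ord P (\prod_i a i) = \sum_i ord P (a i).
Proof.
move=> a0; have [] : \prod_i a i != 0 /\ ord P (\prod_i a i) = \sum_i ord P (a i); last by [].
elim/big_rec2: _ => [|i s b _ [b0 <-]]; first by rewrite oner_neq0 ord1.
by rewrite mulf_neq0 // ordM.
Qed.

(** A vanishing sum is a separate alternative because [ord] is 0 at 0, where the value should be
    infinite. *)
Lemma ord_sum_gt (I : finType) (B : pred I) (z : I -> E) (c : int) :
  (forall i, B i -> z i = 0 \/ c < ord P (z i)) ->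
  \sum_(i | B i) z i = 0 \/ c < ord P (\sum_(i | B i) z i).
Proof.
move=> h; elim/big_rec: _ => [|i s Bi hs]; first by left.
have [s0|s0] := eqVneq s 0; first by rewrite s0 addr0; apply: h.
have [zi0|zi0] := eqVneq (z i) 0; first by rewrite zi0 add0r.
have [e|e] := eqVneq (z i + s) 0; [by left|right].
case: (h i Bi) => [/eqP|hi]; first by rewrite (negbTE zi0).
case: hs => [/eqP|{}hs]; first by rewrite (negbTE s0).
by apply: (lt_le_trans _ (ordD P zi0 s0 e)); rewrite lt_min hi hs.
Qed.

Lemma ord_nneg_sum (I : finType) (z : I -> E) :
  (forall i, 0 <= ord P (z i)) -> 0 <= ord P (\sum_i z i).
Proof.
move=> h; have [|->|] := @ord_sum_gt I predT z (-1); last by rewrite -lezD1 addNr.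
  by move=> i _; right; apply: (lt_le_trans _ (h i)).
by rewrite Defs.ord0.
Qed.

Lemma ord_nneg_add a b : 0 <= ord P a -> 0 <= ord P b -> 0 <= ord P (a + b).
Proof.
have [->|a0] := eqVneq a 0; first by rewrite add0r.
have [->|b0] := eqVneq b 0; first by rewrite addr0.
have [->|ab0] := eqVneq (a + b) 0; first by rewrite Defs.ord0.
by move=> ha hb; apply: le_trans (ordD P a0 b0 ab0); rewrite le_min ha.
Qed.

Lemma ord_nneg_mul a b : 0 <= ord P a -> 0 <= ord P b -> 0 <= ord P (a * b).
Proof.
have [->|a0] := eqVneq a 0; first by rewrite mul0r.
have [->|b0] := eqVneq b 0; first by rewrite mulr0.
by move=> ha hb; rewrite ordM // addr_ge0.
Qed.

Lemma ord_const_nneg c : 0 <= ord P (iota c).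
Proof.
have [->|c0] := eqVneq c 0; first by rewrite rmorph0 Defs.ord0.
by rewrite ord_const.
Qed.

Lemma ordN a : ord P (- a) = ord P a.
Proof.
have [->|a0] := eqVneq a 0; first by rewrite oppr0.
have e : - a = iota (-1) * a by rewrite rmorphN1 mulN1r.
by rewrite e ordM ?fmorph_eq0 ?oppr_eq0 ?oner_neq0 // ord_const ?add0r // oppr_eq0 oner_neq0.
Qed.

Lemma ord_add_lt a b : a != 0 -> b = 0 \/ ord P a < ord P b ->
  a + b != 0 /\ ord P (a + b) = ord P a.
Proof.
move=> a0 [->|lt]; first by rewrite addr0.
have [->|b0] := eqVneq b 0; first by rewrite addr0.
have ab0 : a + b != 0.
  by apply: contraTneq lt => /eqP; rewrite addr_eq0 => /eqP ->; rewrite ordN ltxx.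
split=> //; apply/eqP; rewrite eq_le andbC.
have := ordD P a0 b0 ab0; rewrite min_l ?(ltW lt) // => -> /=.
have nb0 : - b != 0 by rewrite oppr_eq0.
have := ordD P ab0 nb0; rewrite addrK => /(_ a0); rewrite ordN ge_min.
by case/orP => // /(lt_le_trans lt); rewrite ltxx.
Qed.

(** The term of least value is alone at its value, so by the strict triangle inequality it decides
    the value of the sum. *)
Lemma ord_sum (I : finType) (z : I -> E) :
  (forall i j, z i != 0 -> z j != 0 -> ord P (z i) = ord P (z j) -> i = j) ->
  (exists i, z i != 0) ->
  \sum_i z i != 0 /\
  exists i, [/\ z i != 0, ord P (\sum_i z i) = ord P (z i)
    & forall j, z j != 0 -> ord P (z i) <= ord P (z j)].
Proof.
move=> inj [i0 zi0].
pose i := [arg min_(i < i0 | z i != 0) ord P (z i)]%O.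
have [zi hmin] : z i != 0 /\ forall j, z j != 0 -> ord P (z i) <= ord P (z j).
  by rewrite /i; case: arg_minP.
have rest : \sum_(j | j != i) z j = 0 \/ ord P (z i) < ord P (\sum_(j | j != i) z j).
  apply: ord_sum_gt => j ji; have [zj|zj] := eqVneq (z j) 0; [by left|right].
  rewrite lt_neqAle hmin // andbT; apply: contra ji => /eqP e.
  by rewrite (inj i j).
have [s0 es] := ord_add_lt zi rest.
by rewrite (bigD1 i) //=; split=> //; exists i; rewrite zi.
Qed.

End PlaceTheory.

Section Fractions.
Local Open Scope quotient_scope.

Lemma fraction_num_den (R : idomainType) (r : {fraction R}) :
  exists a b, b != 0 /\ r = FracField.tofrac a / FracField.tofrac b.
Proof.
elim/quotW: r => u; exists (frac u).1, (frac u).2; split; first exact: denom_ratioP.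
have d0 := denom_ratioP u.
apply: (mulIf (x := FracField.tofrac (frac u).2)); first by rewrite tofrac_eq0.
rewrite mulfVK ?tofrac_eq0 //; unlock FracField.tofrac.
rewrite -[LHS]FracField.pi_mul; apply/eqmodP; rewrite /= FracField.equivfE /FracField.mulf.
by rewrite !numden_Ratio ?mulr1 ?oner_neq0 ?mulf_neq0 ?oner_neq0 //= mulrC.
Qed.

End Fractions.

(** * Polynomials in x inside the function field *)

Section RationalSubfield.
Variables (K : fieldType) (F : fieldExtType {fraction {poly K}}).

Definition ff_poly (a : {poly K}) : F := (FracField.tofrac a)%:A.

Fact ff_poly_zmod_morphism : zmod_morphism ff_poly.
Proof. by move=> a b; rewrite /ff_poly rmorphB scalerBl. Qed.

Fact ff_poly_monoid_morphism : monoid_morphism ff_poly.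
Proof.
by split=> [|a b]; rewrite /ff_poly -!in_algE ?rmorph1 ?rmorphM ?rmorph1.
Qed.

HB.instance Definition _ := GRing.isZmodMorphism.Build {poly K} F ff_poly
  ff_poly_zmod_morphism.
HB.instance Definition _ := GRing.isMonoidMorphism.Build {poly K} F ff_poly
  ff_poly_monoid_morphism.

Local Notation pe := ff_poly.
Local Notation x := (pe 'X).

Lemma ff_polyC c : pe c%:P = ff_const F c. Proof. by []. Qed.

Lemma ff_poly_eq0 a : (pe a == 0) = (a == 0).
Proof. by rewrite /ff_poly -in_algE fmorph_eq0 tofrac_eq0. Qed.

Lemma fraction_quotient (r : {fraction {poly K}}) :
  exists a b, b != 0 /\ r%:A = pe a / pe b.
Proof.
have [a [b [b0 er]]] := fraction_num_den r; exists a, b; split=> //.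
by rewrite er -in_algE rmorphM fmorphV.
Qed.

Variable P : place (ff_const F).

Lemma ord_poly_nneg a : 0 <= ord P x -> 0 <= ord P (pe a).
Proof.
move=> hx; elim/poly_ind: a => [|a c IH]; first by rewrite rmorph0 Defs.ord0.
rewrite rmorphD rmorphM /= ff_polyC; apply: ord_nneg_add; last exact: ord_const_nneg.
exact: ord_nneg_mul.
Qed.

(** If [a] had positive value too, Bezout would give 1 a positive value. *)
Lemma ord_poly_coprime r a : 0 <= ord P x -> 0 < ord P (pe r) -> coprimep r a ->
  ord P (pe a) = 0.
Proof.
move=> hx hr /Bezout_eq1_coprimepP[[u v] /= e].
have pr0 : pe r != 0 by apply: contraTneq hr => ->; rewrite Defs.ord0.
have [a0|a0] := eqVneq (pe a) 0; first by rewrite a0 Defs.ord0.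
apply/eqP; rewrite eq_le ord_poly_nneg // andbT leNgt; apply/negP => ha.
have : 1 = 0 :> F \/ 0 < ord P (1 : F).
  rewrite -(rmorph1 pe) -e rmorphD !rmorphM.
  have pos b c : 0 < ord P (pe c) -> pe b * pe c = 0 \/ 0 < ord P (pe b * pe c).
    move=> hc; have [b0|b0] := eqVneq (pe b) 0; first by left; rewrite b0 mul0r.
    have c0 : pe c != 0 by apply: contraTneq hc => ->; rewrite Defs.ord0.
    by right; rewrite ordM // ltr_wpDl // ord_poly_nneg.
  have := @ord_sum_gt _ _ _ P bool predT (fun b => if b then pe u * pe r else pe v * pe a) 0.
  by rewrite big_bool /=; apply => -[] _; apply: pos.
by rewrite ord1 ltxx => -[/eqP|//]; rewrite oner_eq0.
Qed.

(** At a pole of x the leading term alone has the lowest value, so only the degree counts. *)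
Lemma ord_poly_infty a : ord P x < 0 -> a != 0 ->
  ord P (pe a) = (size a).-1%:Z * ord P x.
Proof.
move=> hx; have x0 : x != 0 by apply: contraTneq hx => ->; rewrite Defs.ord0.
elim/poly_ind: a => [|a c IH]; first by rewrite eqxx.
have [a0 ac0|a0 _] := eqVneq a 0.
  move: ac0; rewrite a0 mul0r add0r polyC_eq0 => c0.
  by rewrite ff_polyC ord_const // size_polyC c0 mul0r.
have pa0 : pe a != 0 by rewrite ff_poly_eq0.
have e : ord P (pe (a * 'X)) = (size a)%:Z * ord P x.
  rewrite rmorphM ordM // IH //.
  by rewrite -{2}[size a]prednK ?size_poly_gt0 // intS mulrDl mul1r addrC.
rewrite size_MXaddC (negbTE a0) /= -e rmorphD.
have [] := @ord_add_lt _ _ _ P (pe (a * 'X)) (pe c%:P); last by [].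
  by rewrite rmorphM mulf_neq0.
have [->|c0] := eqVneq c 0; [by left; rewrite rmorph0|right].
rewrite ff_polyC ord_const // e nmulr_llt0 // ltz_nat size_poly_gt0 //.
Qed.

End RationalSubfield.

(** * Places over irreducible polynomials, over infinity and over a point alpha *)

Section PlacesOverLine.
Variables (K : fieldType) (F : fieldExtType {fraction {poly K}}).

Local Notation pe := (@ff_poly K F).
Local Notation x := (pe 'X).

Lemma place_over_irreducible r : irreducible_poly r ->
  exists P : place (ff_const F), 0 <= ord P x /\ 0 < ord P (pe r).
Proof.
move=> irr; have r0 : r != 0 by apply: irredp_neq0.
have [||||P [h1 h2]] := @place_exists K _ F (ff_const F) pe _ _ r irr.
- by [].
- by move=> s; have [a [b [b0 e]]] := fraction_quotient F s; exists a, b; rewrite ff_poly_eq0.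
- by rewrite ff_poly_eq0.
- move=> a; rewrite -rmorphM -(rmorph1 pe) -subr_eq0 -rmorphB ff_poly_eq0 subr_eq0.
  apply: contraTneq (irr.1) => ar1; have /eqP := congr1 (fun b : {poly K} => size b) ar1.
  rewrite size_poly1 -leqNgt.
  have a0 : a != 0 by apply: contraPneq ar1 => ->; rewrite mul0r => /esym/eqP; rewrite oner_eq0.
  rewrite size_mul //; have : (0 < size a)%N by rewrite size_poly_gt0.
  by case: (size a) (size r) => // s' s _ /eqP; rewrite addSn => /eqP; lia.
by exists P.
Qed.

(** A pole of x is a place at the prime 1/x of K[1/x]: the construction is applied to [pi],
    evaluation at 1/x. *)
Lemma place_over_infinity : exists P : place (ff_const F), ord P x < 0.
Proof.
have x0 : x != 0 by rewrite ff_poly_eq0 polyX_eq0.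
have cx : commr_rmorph (ff_const F) x^-1 by move=> c; apply: mulrC.
pose pi : {rmorphism {poly K} -> F} := horner_morph cx.
have piC c : pi c%:P = ff_const F c by apply: horner_morphC.
have piX : pi 'X = x^-1 by apply: horner_morphX.
have dehom a : exists s, exists2 b, pi a * x ^+ s = pe b & (size b <= s.+1)%N.
  elim/poly_ind: a => [|a c [s [b e sb]]]; first by exists 0%N, 0; rewrite ?rmorph0 ?mul0r ?size_poly0.
  exists s.+1, (b + c%:P * 'X^(s.+1)).
    rewrite !rmorphD !rmorphM /= piX piC ff_polyC rmorphXn /= -e exprS; field; exact: x0.
  rewrite (leq_trans (size_polyD _ _)) // geq_max (leq_trans sb) //=.
  rewrite (leq_trans (size_polyMleq _ _)) // size_polyXn.
  by have := size_polyC_leq1 c; case: (size _) => [|[]].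
have hom a : exists2 s, exists b, pe a = pi b / pi ('X ^+ s) & True.
  elim/poly_ind: a => [|a c [s [b e] _]]; first by exists 0%N => //; exists 0; rewrite !rmorph0 mul0r.
  exists s.+1 => //; exists (b + c%:P * 'X^(s.+1)).
  rewrite !rmorphD !rmorphM /= e piC ff_polyC !rmorphXn /= piX exprS; field.
  by rewrite x0 expf_neq0 // invr_eq0.
have irX : irreducible_poly ('X : {poly K}) by have := irredp_XsubC (0 : K); rewrite subr0.
have [||||P [h1 h2]] := @place_exists K _ F (ff_const F) pi _ _ 'X irX.
- exact: piC.
- move=> r; have [a [b [b0 e]]] := fraction_quotient F r.
  have [s [a' ea] _] := hom a; have [s' [b' eb] _] := hom b.
  have X0 k : pi ('X ^+ k) != 0 by rewrite rmorphXn /= piX expf_neq0 // invr_eq0.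
  have b'0 : pi b' != 0.
    by move: b0; rewrite -(ff_poly_eq0 F) eb mulf_eq0 negb_or => /andP[].
  exists (a' * 'X^s'), (b' * 'X^s); rewrite !rmorphM mulf_neq0 //; split=> //.
  by rewrite e ea eb; field; rewrite !X0 b'0.
- by rewrite piX invr_eq0.
(* An inverse of 1/x in K[1/x] would, after clearing denominators, make x^(s+1) a polynomial of
   degree at most s. *)
- move=> a; apply/negP => /eqP; rewrite piX => e.
  have [s [b eb sb]] := dehom a.
  have : pe ('X^(s.+1) - b) == 0.
    rewrite rmorphB rmorphXn /= -eb exprS -[X in X * _]mulr1 -e.
    by rewrite subr_eq0; apply/eqP; field; exact: x0.
  rewrite ff_poly_eq0 subr_eq0 => /eqP eX; move: sb.
  by rewrite -eX size_polyXn ltnn.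
exists P; move: h1; rewrite piX ordV // oppr_gt0.
by [].
Qed.

Variable alpha : K.
Local Notation xa := (pe ('X - alpha%:P)).
Implicit Types P : place (ff_const F).

Lemma ord_x_over P : 0 < ord P xa -> 0 <= ord P x.
Proof.
move=> h; have -> : x = xa + pe alpha%:P by rewrite -rmorphD subrK.
by apply: ord_nneg_add; [apply: ltW|rewrite ff_polyC ord_const_nneg].
Qed.

Lemma ord_over_nonroot P a : 0 < ord P xa -> ~~ root a alpha -> ord P (pe a) = 0.
Proof.
move=> h na; apply: ord_poly_coprime (ord_x_over h) h _.
by rewrite coprimep_sym coprimep_XsubC.
Qed.

(** The multiplicity [s] is chosen before the place; this uniformity later allows two places over
    the same point to be compared. *)
Lemma ord_over_multiplicity (r : {fraction {poly K}}) : r != 0 ->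
  exists s : int, forall P : place (ff_const F), 0 < ord P xa -> ord P (r%:A) = ord P xa * s.
Proof.
have mult a : a != 0 -> exists s : nat,
    forall P : place (ff_const F), 0 < ord P xa -> ord P (pe a) = ord P xa * s%:Z.
  move=> a0; have [s [b nb e]] := multiplicity_XsubC a alpha.
  exists s => P h; rewrite a0 in nb.
  have b0 : b != 0 by apply: contraNneq nb => ->; rewrite root0.
  rewrite e rmorphM rmorphXn /= ordM ?expf_neq0 ?ff_poly_eq0 ?polyXsubC_eq0 //.
  by rewrite ord_over_nonroot // add0r ordX ?ff_poly_eq0 ?polyXsubC_eq0 // mulrC.
move=> r0; have [a [b [b0 e]]] := fraction_quotient F r.
have a0 : a != 0.
  apply: contraNneq r0 => a0; move/eqP: e.
  by rewrite a0 rmorph0 mul0r scaler_eq0 oner_eq0 orbF.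
have [s hs] := mult a a0; have [s' hs'] := mult b b0.
exists (s%:Z - s'%:Z) => P h.
by rewrite e ordM ?invr_eq0 ?ff_poly_eq0 // ordV ?ff_poly_eq0 // hs // hs' // mulrBr.
Qed.

End PlacesOverLine.

(** * The Beelen-Montanucci function field *)

Section BMPolynomials.
Variables (K : fieldType) (q : nat).
Hypothesis q_gt1 : (1 < q)%N.
Hypothesis pcharq : [pchar K].-nat q.

Definition BM_d : {poly K} := 'X^(q.+1) - 1.
Definition BM_w : {poly K} := 'X * ('X^(q ^ 2 - 1) - BM_d ^+ (q - 1)).

Lemma natr_q_eq0 : q%:R = 0 :> K.
Proof.
have := pi_pdiv q; rewrite q_gt1 => /(pnatPpi pcharq) pc.
by apply/eqP; rewrite -(dvdn_pcharf pc) pdiv_dvd.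
Qed.

Let q2_gt1 : (1 < q ^ 2)%N.
Proof. by have := @ltn_exp2r 1 q 2 isT; rewrite exp1n => ->. Qed.

(** By Frobenius d^q = x^(q(q+1)) - 1, and the top terms of x^(q^2) d and x d^q cancel. *)
Lemma BM_dw : BM_d * BM_w = 'X - 'X^(q ^ 2).
Proof.
have q2 : (0 < q ^ 2)%N by rewrite expn_gt0 ltnW.
have pq : [pchar {poly K}].-nat q by rewrite (eq_pnat _ (pchar_poly K)).
have dq : BM_d ^+ q = 'X^(q.+1 * q) - 1.
  by apply/eqP; rewrite eq_sym subr_eq -[X in _ + X](expr1n _ q) -exprDn_pchar // subrK exprM.
have -> : BM_d * BM_w = BM_d * ('X * 'X^(q ^ 2 - 1)) - 'X * (BM_d * BM_d ^+ (q - 1)).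
  by rewrite /BM_w; ring.
rewrite -!exprS !subn1 !prednK ?(ltnW q_gt1) // dq /BM_d.
rewrite mulrBl mulrBr -exprD -exprS mulr1 mul1r.
have -> : (q.+1 + q ^ 2 = (q.+1 * q).+1)%N by rewrite expnS expn1; lia.
by ring.
Qed.

Lemma BM_dw_neq0 : BM_d * BM_w != 0.
Proof.
rewrite BM_dw -size_poly_gt0 -opprB size_polyN.
by rewrite size_polyDl ?size_polyN ?size_polyXn ?size_polyX.
Qed.

Lemma BM_d_neq0 : BM_d != 0.
Proof. by apply: contraNneq BM_dw_neq0 => ->; rewrite mul0r. Qed.

Lemma BM_w_neq0 : BM_w != 0.
Proof. by apply: contraNneq BM_dw_neq0 => ->; rewrite mulr0. Qed.

Lemma size_BM_d : size BM_d = q.+2.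
Proof. by rewrite /BM_d size_XnsubC. Qed.

(** The leading terms cancel inside the definition of [BM_w], so its degree is obtained from that of
    the product with [BM_d]. *)
Lemma size_BM_w : size BM_w = (q ^ 2 - q)%N.
Proof.
have sz : size (BM_d * BM_w) = (q ^ 2).+1.
  by rewrite BM_dw -opprB size_polyN size_polyDl ?size_polyN ?size_polyXn ?size_polyX.
move: sz; rewrite size_mul ?BM_d_neq0 ?BM_w_neq0 // size_BM_d addSn /=.
by move=> /eqP; rewrite addSn eqSS => /eqP <-; rewrite addKn.
Qed.

(** The derivative of x - x^(q^2) is 1 in characteristic dividing q. *)
Lemma irreducible_sqr_ndvd_BM_dw r : irreducible_poly r -> ~~ (r ^+ 2 %| BM_d * BM_w).
Proof.
move=> irr; apply/negP => /dvdpP[s e].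
have der : (BM_d * BM_w)^`() = 1.
  rewrite BM_dw derivB derivX derivXn -mulr_natr natrX.
  have -> : (q%:R : {poly K}) = 0 by rewrite -polyC_natr natr_q_eq0.
  by rewrite expr0n /= mulr0 subr0.
have : r %| 1.
  rewrite -der e; apply/dvdpP; exists (s^`() * r + s * r^`() *+ 2).
  by rewrite expr2 !derivM; ring.
by rewrite dvdp1; case: irr => + _ => /ltn_eqF; rewrite eq_sym => ->.
Qed.

Variables (F : fieldExtType {fraction {poly K}}) (P : place (ff_const F)).
Local Notation pe := (@ff_poly K F).

(** As the product is squarefree, [r] divides at most one of the two factors, and exactly once. *)
Lemma ord_BM_dw_cases r : irreducible_poly r -> 0 <= ord P (pe 'X) -> 0 < ord P (pe r) ->
  [\/ ~~ (r %| BM_d) /\ ord P (pe BM_d) = 0 /\ ord P (pe BM_w) = 0,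
      r %| BM_d /\ ord P (pe BM_d) = ord P (pe r) /\ ord P (pe BM_w) = 0
    | ~~ (r %| BM_d) /\ ord P (pe BM_d) = 0 /\ ord P (pe BM_w) = ord P (pe r)].
Proof.
move=> irr hx hr.
have cop a : ~~ (r %| a) -> ord P (pe a) = 0.
  by move=> ra; apply: ord_poly_coprime hx hr _; rewrite irreducible_poly_coprime.
have r0 : r != 0 := irredp_neq0 irr.
have sqf a b : a * b = BM_d * BM_w -> r %| a -> ord P (pe a) = ord P (pe r) /\ ord P (pe b) = 0.
  move=> e /dvdpP[c ec].
  have nsq := irreducible_sqr_ndvd_BM_dw irr.
  have rc : ~~ (r %| c).
    apply: contra nsq => /dvdpP[c' ec'].
    by rewrite -e ec ec'; apply/dvdpP; exists (c' * b); ring.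
  have rb : ~~ (r %| b).
    by apply: contra nsq => /dvdpP[c' ec']; rewrite -e ec ec'; apply/dvdpP; exists (c * c'); ring.
  split; last exact: cop.
  have c0 : c != 0 by apply: contraNneq rc => ->; rewrite dvdp0.
  rewrite ec rmorphM /= ordM ?ff_poly_eq0 //.
  by rewrite (cop c) ?add0r.
have [rd|rd] := boolP (r %| BM_d); first by constructor 2; split=> //; apply: (sqf _ _ erefl).
have [rw|rw] := boolP (r %| BM_w); last by constructor 1; rewrite !cop.
by constructor 3; split=> //; have [] := sqf BM_w BM_d (mulrC _ _) rw.
Qed.

End BMPolynomials.

(** * The Kummer generator y at the places over a root of d *)

Section BMKummer.
Variables (K : fieldType) (F : fieldExtType {fraction {poly K}}).
Variables (q m : nat) (y : F).
Hypothesis q_gt1 : (1 < q)%N.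
Hypothesis pcharq : [pchar K].-nat q.
Hypothesis m_gt0 : (0 < m)%N.

Local Notation k := {fraction {poly K}}.
Local Notation pe := (@ff_poly K F).
Local Notation x := (pe 'X).
Local Notation d := (BM_d K q).
Local Notation w := (BM_w K q).

Hypothesis yE : y ^+ m = pe (d * w ^+ q.+1).
Hypothesis y_gen : <<1; y>>%VS = fullv.

Implicit Types (P : place (ff_const F)) (g : 'I_m -> k).

Lemma BM_y_neq0 : y != 0.
Proof.
apply/eqP => y0; move: yE; rewrite y0 expr0n eqn0Ngt m_gt0 /= => /esym/eqP.
by rewrite ff_poly_eq0 mulf_eq0 expf_eq0 /= (negbTE (BM_d_neq0 q_gt1 pcharq))
  (negbTE (BM_w_neq0 q_gt1 pcharq)).
Qed.

Lemma ord_y P : m%:Z * ord P y = ord P (pe d) + q.+1%:Z * ord P (pe w).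
Proof.
have d0 : pe d != 0 by rewrite ff_poly_eq0; apply: BM_d_neq0.
have w0 : pe w != 0 by rewrite ff_poly_eq0; apply: BM_w_neq0.
by rewrite -ordX ?BM_y_neq0 // yE rmorphM rmorphXn /= ordM ?expf_neq0 // ordX.
Qed.

Lemma kummer_poly_root : root ('X^m - (pe (d * w ^+ q.+1))%:P) y.
Proof. by rewrite /root !hornerE yE subrr. Qed.

Lemma minPoly_dvd_kummer : minPoly 1%AS y %| 'X^m - (pe (d * w ^+ q.+1))%:P.
Proof.
apply: minPoly_dvdp kummer_poly_root.
by rewrite rpredB ?rpredX ?polyOverX // polyOverC /ff_poly rpredZ ?mem1v.
Qed.

Lemma adjoin_degree_kummer : (adjoin_degree 1%AS y <= m)%N.
Proof.
have := dvdp_leq _ minPoly_dvd_kummer; rewrite size_minPoly size_XnsubC // ltnS.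
by apply; rewrite -size_poly_gt0 size_XnsubC.
Qed.

Lemma kummer_decomposition z : exists g, z = \sum_i (g i)%:A * y ^+ i.
Proof.
have zy : z \in <<1%AS; y>>%VS by rewrite y_gen memvf.
have /polyOver1P[c ec] : Fadjoin_poly 1%AS y z \is a polyOver 1%VS by apply: Fadjoin_polyOver.
exists (fun i => c`_i); rewrite -{1}(Fadjoin_poly_eq zy).
rewrite (horner_coef_wide _ (leq_trans (size_Fadjoin_poly _ _ _) adjoin_degree_kummer)).
by apply: eq_bigr => i _; rewrite ec coef_map.
Qed.

Section OverRoot.
Variable alpha : K.
Hypothesis d_alpha : root d alpha.
Local Notation xa := (pe ('X - alpha%:P)).

Lemma ord_y_over P : 0 < ord P xa -> m%:Z * ord P y = ord P xa.
Proof.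
move=> h; rewrite ord_y; have dv : 'X - alpha%:P %| d by rewrite dvdp_XsubCl.
case: (ord_BM_dw_cases q_gt1 pcharq (irredp_XsubC alpha) (ord_x_over h) h).
- by rewrite dv => -[].
- by move=> [_ [-> ->]]; rewrite mulr0 addr0.
- by rewrite dv => -[].
Qed.

Lemma ord_y_over_gt0 P : 0 < ord P xa -> 0 < ord P y.
Proof. by move=> h; have := h; rewrite -ord_y_over // pmulr_rgt0. Qed.

Lemma term_neq0 (r : k) (i : nat) : (r%:A * y ^+ i != 0) = (r != 0).
Proof.
rewrite mulf_eq0 expf_eq0 (negbTE BM_y_neq0) andbF orbF.
by rewrite scaler_eq0 oner_eq0 orbF.
Qed.

Lemma ord_term_over (r : k) : r != 0 -> exists s : int, forall P, 0 < ord P xa ->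
  forall i : nat, ord P (r%:A * y ^+ i) = ord P y * (m%:Z * s + i%:Z).
Proof.
move=> r0; have [s hs] := ord_over_multiplicity F alpha r0; exists s => P h i.
have rA0 : r%:A != 0 :> F by rewrite scaler_eq0 oner_eq0 orbF.
rewrite ordM ?expf_neq0 ?BM_y_neq0 // ordX ?BM_y_neq0 // hs // -ord_y_over //.
by ring.
Qed.

Lemma eq_index_mod (i j : 'I_m) (s t : int) :
  m%:Z * s + i%:Z = m%:Z * t + j%:Z -> i = j.
Proof.
move=> e; have /(congr1 (fun z => (z %% m%:Z)%Z)) := e.
rewrite ![m%:Z * _]mulrC !modzMDl !modz_small ?ltz_nat ?ltn_ord //.
by move=> [] /val_inj.
Qed.

Lemma ord_sum_over P g : 0 < ord P xa -> (exists i, g i != 0) ->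
  \sum_i (g i)%:A * y ^+ i != 0 /\
  exists i, [/\ g i != 0, ord P (\sum_i (g i)%:A * y ^+ i) = ord P ((g i)%:A * y ^+ i)
    & forall j, g j != 0 -> ord P ((g i)%:A * y ^+ i) <= ord P ((g j)%:A * y ^+ j)].
Proof.
move=> h [i0 gi0].
have [||s0 [i [gi e hi]]] := @ord_sum _ _ _ P 'I_m (fun i => (g i)%:A * y ^+ i).
- move=> i j; rewrite !term_neq0 => gi gj.
  have [s hs] := ord_term_over gi; have [t ht] := ord_term_over gj.
  rewrite hs // ht // => /(mulfI (lt0r_neq0 (ord_y_over_gt0 h))).
  exact: eq_index_mod.
- by exists i0; rewrite term_neq0.
split=> //; exists i; rewrite term_neq0 in gi; split=> // j gj.
by apply: hi; rewrite term_neq0.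
Qed.

(** Every nonzero function has a value divisible by [ord P y], and some function has value 1: this
    is total ramification. *)
Lemma ord_y_over1 P : 0 < ord P xa -> ord P y = 1.
Proof.
move=> h; have [z z1] := ord_surj P.
have [g ez] := kummer_decomposition z.
have [|_ [i [gi e _]]] := @ord_sum_over P g h.
  apply: contrapT => no; move: z1; rewrite ez big1 ?Defs.ord0 // => i _.
  by case: (eqVneq (g i) 0) => [->|gi]; [rewrite scale0r mul0r|case: no; exists i].
have [s hs] := ord_term_over gi.
move: e; rewrite -ez z1 hs // => /esym e.
have := ord_y_over_gt0 h.
have : (ord P y %| 1)%Z by apply/dvdzP; exists (m%:Z * s + i%:Z); rewrite mulrC e.
rewrite dvdz1 => /eqP a1 pos.
by rewrite -(gtz0_abs pos) a1.
Qed.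

Lemma ord_term_over1 (r : k) : r != 0 -> exists s : int, forall P, 0 < ord P xa ->
  forall i : nat, ord P (r%:A * y ^+ i) = m%:Z * s + i%:Z.
Proof.
move=> r0; have [s hs] := ord_term_over r0; exists s => P h i.
by rewrite hs // ord_y_over1 // mul1r.
Qed.

(** The value of each term is given by a formula that does not involve the place, and the value of a
    sum is the least of those of its terms. *)
Lemma place_over_unique P P' : 0 < ord P xa -> 0 < ord P' xa -> P = P'.
Proof.
move=> h h'; apply: place_ext => z.
have [->|z0] := eqVneq z 0; first by rewrite !Defs.ord0.
have [g ez] := kummer_decomposition z.
have gn0 : exists i, g i != 0.
  apply: contrapT => no; move: z0; rewrite ez big1 ?eqxx // => i _.
  by case: (eqVneq (g i) 0) => [->|gi]; [rewrite scale0r mul0r|case: no; exists i].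
have [_ [i [gi e hi]]] := ord_sum_over h gn0.
have [_ [i' [gi' e' hi']]] := ord_sum_over h' gn0.
have same j : g j != 0 -> ord P ((g j)%:A * y ^+ j) = ord P' ((g j)%:A * y ^+ j).
  by move=> gj; have [s hs] := ord_term_over1 gj; rewrite !hs.
have s1 := same i gi; have s2 := same i' gi'.
have le1 := hi i' gi'; have le2 := hi' i gi.
rewrite ez; apply: (etrans e); apply: (etrans _ (esym e')); rewrite -s2.
by apply/eqP; rewrite eq_le le1 /= s2 s1.
Qed.

(** A relation of degree below [m] would be a vanishing sum of terms with distinct values; the place
    [P] thus serves as an irreducibility criterion. *)
Lemma minPoly_kummer P : 0 < ord P xa ->
  minPoly 1%AS y = 'X^m - (pe (d * w ^+ q.+1))%:P.
Proof.
move=> h; apply/eqP; rewrite -eqp_monic ?monic_minPoly ?monicXnsubC //.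
rewrite -dvdp_size_eqp ?minPoly_dvd_kummer // size_XnsubC // size_minPoly eqSS.
rewrite eqn_leq adjoin_degree_kummer leqNgt; apply/negP => lt.
have /polyOver1P[c ec] : minPoly 1%AS y \is a polyOver 1%VS by apply: minPolyOver.
have [|/negP[]] := @ord_sum_over P (fun i => c`_i) h.
  exists (Ordinal lt) => /=.
  have := monicP (monic_minPoly 1%AS y); rewrite lead_coefE size_minPoly /= ec coef_map /= => e.
  by apply: contra_eqN e => /eqP ->; rewrite scale0r eq_sym oner_eq0.
have sz : (size (minPoly 1%AS y) <= m)%N by rewrite size_minPoly.
have := root_minPoly 1%AS y; rewrite /root (horner_coef_wide _ sz) ec.
by under eq_bigr => i _ do rewrite coef_map.
Qed.

Lemma kummer_conjugation P (zeta : K) : 0 < ord P xa -> zeta ^+ m = 1 ->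
  exists sigma : {rmorphism F -> F}, forall (r : k) (i : nat),
    sigma (r%:A * y ^+ i) = ff_const F (zeta ^+ i) * (r%:A * y ^+ i).
Proof.
move=> h z1; pose f := kHomExtend 1%AS \1%VF y (ff_const F zeta * y).
have hom1 : kHom 1%AS 1%AS (\1%VF : 'End(F)) by apply: kHom1.
have rt : root (map_poly (\1%VF : 'End(F)) (minPoly 1%AS y)) (ff_const F zeta * y).
  rewrite (eq_map_poly (g := idfun)); last by move=> z; rewrite id_lfunE.
  rewrite map_poly_id // (minPoly_kummer h) /root !hornerE exprMn -rmorphXn z1.
  by rewrite rmorph1 mul1r yE subrr.
have fhom : kHom 1%AS {:F} f.
  by have := kHomExtendP (subvv _) hom1 rt; rewrite y_gen.
have fy : f y = ff_const F zeta * y by apply: kHomExtend_val hom1 rt.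
have fm : monoid_morphism f by apply/kHom_monoid_morphism.
pose fa := GRing.isMonoidMorphism.Build F F f fm.
have fz : zmod_morphism f by move=> a b; rewrite linearB.
pose fb := GRing.isZmodMorphism.Build F F f fz.
pose sigma : {rmorphism F -> F} := HB.pack (f : F -> F) fb fa.
exists sigma => r i.
rewrite rmorphM rmorphXn /=.
have -> : f (r%:A) = r%:A by rewrite linearZ /= fm.1.
by rewrite fy exprMn -rmorphXn mulrCA.
Qed.

End OverRoot.
End BMKummer.

Lemma irreducible_divisor (K : fieldType) (b : {poly K}) : (1 < size b)%N ->
  exists2 r : {poly K}, irreducible_poly r & r %| b.
Proof.
have [s] := ubnP (size b); elim: s b => // s IH b sb b1.
have [irb|nirb] := pselect (irreducible_poly b); first by exists b.
have [r [r1 rb nrb]] : exists r : {poly K}, [/\ size r != 1, r %| b & ~~ (r %= b)].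
  apply: contrapT => no; apply: nirb; split=> // r r1 rb.
  by apply: contrapT => /negP nrb; apply: no; exists r.
have b0 : b != 0 by rewrite -size_poly_gt0 (ltn_trans _ b1).
have r0 : r != 0 by apply: contraTneq rb => ->; rewrite dvd0p.
have lt : (size r < size b)%N.
  by rewrite ltn_neqAle dvdp_size_eqp // nrb dvdp_leq.
have [||t irt tr] := IH r; first exact: leq_trans lt _.
  by rewrite ltn_neqAle eq_sym r1 size_poly_gt0.
by exists t => //; apply: dvdp_trans rb.
Qed.

Lemma fraction_quotient_coprime (K : fieldType) (F : fieldExtType {fraction {poly K}})
    (r : {fraction {poly K}}) :
  exists a b, [/\ b != 0, coprimep a b & r%:A = ff_poly F a / ff_poly F b].
Proof.
have [a [b [b0 e]]] := fraction_quotient F r.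
pose g := gcdp a b; have g0 : g != 0 by rewrite gcdp_eq0 negb_and b0 orbT.
have ea : a = a %/ g * g by rewrite divpK ?dvdp_gcdl.
have eb : b = b %/ g * g by rewrite divpK ?dvdp_gcdr.
exists (a %/ g), (b %/ g); split.
- by apply: contraNneq b0 => e0; rewrite eb e0 mul0r.
- by apply: coprimep_div_gcd; rewrite b0 orbT.
- have bg : b %/ g != 0 by apply: contraNneq b0 => e0; rewrite eb e0 mul0r.
  rewrite e {1}ea {1}eb !rmorphM /=; field.
  by rewrite !ff_poly_eq0 g0 bg.
Qed.

Lemma ord_quotient (K E : fieldType) (L : fieldExtType E) (iota : {rmorphism K -> L})
    (a b : E) : a != 0 -> b != 0 ->
  exists2 h : E, h != 0 & forall P : place iota, ord P a%:A = ord P h%:A + ord P b%:A.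
Proof.
move=> a0 b0; exists (a / b); first by rewrite mulf_neq0 ?invr_eq0.
have e : a%:A = (a / b)%:A * b%:A :> L by rewrite -!in_algE -rmorphM mulfVK.
by move=> P; rewrite e ordM // -in_algE fmorph_eq0 // mulf_neq0 ?invr_eq0.
Qed.

(** Fourier inversion on the cyclic group of order [m]; the exponent [m - i] stands for -i within
    the natural numbers. *)
Lemma unity_root_filter (K E : fieldType) (f : {rmorphism K -> E}) (m : nat) (zeta : K)
    (t : 'I_m -> E) (i : 'I_m) : m.-primitive_root zeta ->
  \sum_(s < m) f (zeta ^+ (s * (m - i))) * (\sum_(j < m) f (zeta ^+ (s * j)) * t j)
    = f m%:R * t i.
Proof.
move=> zetaP.
have fE (s : 'I_m) (j : 'I_m) : f (zeta ^+ (s * (m - i))) * (f (zeta ^+ (s * j)) * t j)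
    = f ((zeta ^+ (m - i + j)) ^+ s) * t j.
  by rewrite mulrA -rmorphM -exprD -mulnDr mulnC exprM.
under eq_bigr => s _ do rewrite mulr_sumr (eq_bigr _ (fun j _ => fE s j)).
rewrite exchange_big (bigD1 i) //= [X in _ + X]big1 ?addr0 => [|j ji].
  rewrite (eq_bigr (fun=> t i)); first by rewrite sumr_const card_ord rmorph_nat mulr_natl.
  by move=> s _; rewrite subnK ?(ltnW (ltn_ord i)) // (prim_expr_order zetaP) expr1n rmorph1 mul1r.
rewrite -mulr_suml -rmorph_sum; set v := zeta ^+ (m - i + j).
have v1 : v != 1.
  rewrite -(prim_order_dvd zetaP); apply: contra ji => /dvdnP[c ec]; apply/eqP/val_inj => /=.
  have im := ltn_ord i; have jm := ltn_ord j.
  by case: c ec => [|[|c]]; [lia|lia|rewrite !mulSn; lia].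
have : (v - 1) * \sum_(s < m) v ^+ s = 0.
  by rewrite -subrX1 /v exprAC (prim_expr_order zetaP) expr1n subrr.
by move/eqP; rewrite mulf_eq0 subr_eq0 (negbTE v1) => /= /eqP ->; rewrite rmorph0 mul0r.
Qed.

(* [power_class i] is the residue modulo [m] of the pole orders of a term
   [g * y ^+ i] at the places over the roots of [BM_d], where [y] has order 1. *)
Section PowerClass.
Variable m : nat.
Hypothesis m_gt0 : (0 < m)%N.

Definition power_class (i : 'I_m) : int := ((- i%:Z) %% m%:Z)%Z.

Let mz_gt0 : 0 < m%:Z. Proof. by rewrite ltz_nat. Qed.
Let mz_neq0 : m%:Z != 0. Proof. by rewrite gt_eqF. Qed.

Lemma power_class_bounds i : 0 <= power_class i < m%:Z.
Proof. by rewrite modz_ge0 // ltz_pmod. Qed.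

Lemma power_classE i : power_class i = (i != 0%N :> nat)%:Z * m%:Z - i%:Z.
Proof.
have im := ltn_ord i; rewrite /power_class; case: eqVneq => [->|i0] /=.
  by rewrite oppr0 mod0z mul0r subr0.
have e : - i%:Z = (-1) * m%:Z + (m%:Z - i%:Z) by ring.
rewrite {1}e modzMDl modz_small; first by rewrite mul1r.
by move: (nat_of_ord i) i0 im => j; lia.
Qed.

Lemma power_class_surj (c : int) : 0 <= c < m%:Z -> exists i, power_class i = c.
Proof.
move=> /andP[c0 cm]; case: c c0 cm => // c _ cm.
have im : ((m - c) %% m < m)%N by rewrite ltn_mod.
rewrite ltz_nat in cm; exists (Ordinal im); rewrite power_classE /=.
have [c0|c0] := posnP c; first by rewrite c0 subn0 modnn mul0r subr0.
rewrite modn_small; last by lia.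
have -> : (m - c)%N != 0%N by lia.
by rewrite mul1r; lia.
Qed.

End PowerClass.

(** * Regularity of terms and the description of the semigroup *)

Section BMRegular.
Variables (K : fieldType) (F : fieldExtType {fraction {poly K}}).
Variables (q m : nat) (y : F).
Hypothesis q_gt1 : (1 < q)%N.
Hypothesis pcharq : [pchar K].-nat q.
Hypothesis m_gt0 : (0 < m)%N.

Local Notation k := {fraction {poly K}}.
Local Notation pe := (@ff_poly K F).
Local Notation x := (pe 'X).
Local Notation d := (BM_d K q).
Local Notation w := (BM_w K q).

Hypothesis yE : y ^+ m = pe (d * w ^+ q.+1).
Hypothesis y_gen : <<1; y>>%VS = fullv.

Variables (zeta : K) (N : nat) (Q : 'I_N -> place (ff_const F)) (alpha : 'I_N -> K).
Hypothesis zetaP : m.-primitive_root zeta.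
Hypothesis N_gt0 : (0 < N)%N.
Hypothesis Q_inj : injective Q.
Hypothesis d_alpha : forall l, root d (alpha l).
Local Notation xa l := (pe ('X - (alpha l)%:P)).
Hypothesis Q_alpha : forall l, 0 < ord (Q l) (xa l).

Implicit Types (P : place (ff_const F)) (g : 'I_m -> k) (J : 'I_N -> int).

Let y0 : y != 0. Proof. exact: BM_y_neq0 q_gt1 pcharq m_gt0 yE. Qed.

Lemma place_is_Q P l : 0 < ord P (xa l) -> P = Q l.
Proof. by move=> h; apply: (place_over_unique q_gt1 pcharq m_gt0 yE y_gen (d_alpha l) h). Qed.

Lemma ord_const_mul P c z : c != 0 -> ord P (ff_const F c * z) = ord P z.
Proof.
move=> c0; have [->|z0] := eqVneq z 0; first by rewrite mulr0.
by rewrite ordM ?fmorph_eq0 // ord_const // add0r.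
Qed.

(** A place [P] composed with the conjugation is again a place. It is none of the [Q l], because the
    conjugation fixes x - alpha_l and only [Q l] lies over its zero; so regularity there is
    regularity of the conjugate at [P]. *)
Lemma regular_conjugate g (s : nat) :
  regular_outside Q (\sum_i (g i)%:A * y ^+ i) ->
  regular_outside Q (\sum_(i < m) ff_const F (zeta ^+ (s * i)) * ((g i)%:A * y ^+ i)).
Proof.
move=> reg P PQ; have l0 : 'I_N := Ordinal N_gt0.
have z1 : (zeta ^+ s) ^+ m = 1 by rewrite exprAC (prim_expr_order zetaP) expr1n.
have zu : zeta ^+ s != 0.
  apply: contra_eqN z1 => /eqP ->; by rewrite expr0n eqn0Ngt m_gt0 eq_sym oner_eq0.
have [sigma hs] := kummer_conjugation q_gt1 pcharq m_gt0 yE y_gen (d_alpha l0) (Q_alpha l0) z1.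
have sr (r : k) : sigma r%:A = r%:A by have := hs r 0%N; rewrite expr0 rmorph1 mul1r !mulr1.
have s0 z : z != 0 -> sigma z != 0 by rewrite fmorph_eq0.
(* Surjectivity of the conjugation provides the composed valuation with an element of value 1. *)
have surj z : exists u, sigma u = z.
  have [h ->] := kummer_decomposition m_gt0 yE y_gen z.
  exists (\sum_(i < m) (ratfun_const K (zeta ^+ s ^- i) * h i)%:A * y ^+ i).
  rewrite rmorph_sum; apply: eq_bigr => i _; rewrite hs.
  have -> (c : K) (r : k) : (ratfun_const K c * r)%:A = ff_const F c * r%:A :> F.
    by rewrite -[LHS]in_algE rmorphM.
  rewrite mulrA mulrA -(rmorphM (ff_const F)) divff; last by rewrite expf_neq0 // zu.
  by rewrite (rmorph1 (ff_const F)) mul1r.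
pose o z := ord P (sigma z).
have o0 : o 0 = 0 by rewrite /o rmorph0 Defs.ord0.
have oM a b : a != 0 -> b != 0 -> o (a * b) = o a + o b.
  by move=> a0 b0; rewrite /o rmorphM ordM ?s0.
have oD a b : a != 0 -> b != 0 -> a + b != 0 -> Num.min (o a) (o b) <= o (a + b).
  by move=> a0 b0 ab0; rewrite /o rmorphD; apply: ordD; rewrite -?rmorphD s0.
have oC c : c != 0 -> o (ff_const F c) = 0 by move=> c0; rewrite /o sr ord_const.
have oS : exists t, o t = 1.
  by have [t t1] := ord_surj P; have [u eu] := surj t; exists u; rewrite /o eu.
pose P' : place (ff_const F) := Place o0 oM oD oC oS.
have P'Q l : P' <> Q l.
  move=> e; apply: (PQ l); apply: place_is_Q.
  by have := Q_alpha l; rewrite -e /= /o sr.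
have := reg P' P'Q; rewrite /= /o rmorph_sum.
by rewrite (eq_bigr (fun i : 'I_m => ff_const F (zeta ^+ (s * i)) * ((g i)%:A * y ^+ i)))
  => // i _; rewrite hs exprM.
Qed.

Lemma regular_component g : regular_outside Q (\sum_i (g i)%:A * y ^+ i) ->
  forall i, regular_outside Q ((g i)%:A * y ^+ i).
Proof.
move=> reg i P PQ.
rewrite -(ord_const_mul P _ (prim_root_natf_neq0 zetaP))
  -(unity_root_filter (ff_const F) (fun j => (g j)%:A * y ^+ j) i zetaP).
apply: ord_nneg_sum => s.
by apply: ord_nneg_mul; [apply: ord_const_nneg|apply: regular_conjugate].
Qed.

Let d0 : pe d != 0. Proof. by rewrite ff_poly_eq0; apply: BM_d_neq0. Qed.
Let w0 : pe w != 0. Proof. by rewrite ff_poly_eq0; apply: BM_w_neq0. Qed.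
Let xa0 l : xa l != 0. Proof. by rewrite ff_poly_eq0 polyXsubC_eq0. Qed.

(** The exponents [J] prescribe the poles at the [Q l]; the negative power of [w] uses up zeros of
    y^i to lower the degree at the poles of x. *)
Definition pole_coef J (phi : nat) : k :=
  (\prod_l FracField.tofrac ('X - (alpha l)%:P) ^ (- J l)) * FracField.tofrac w ^- phi.

Lemma pole_coefE J phi :
  (pole_coef J phi)%:A = (\prod_l xa l ^ (- J l)) * pe w ^- phi :> F.
Proof.
rewrite -[LHS]in_algE rmorphM rmorph_prod fmorphV rmorphXn.
by congr (_ * _); apply: eq_bigr => l _; rewrite fmorphXz.
Qed.

Lemma pole_coef_neq0 J phi : pole_coef J phi != 0.
Proof.
have : (pole_coef J phi)%:A != 0 :> F.
  rewrite pole_coefE; apply: mulf_neq0; last by rewrite invr_eq0 expf_neq0.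
  by apply/prodf_neq0 => l _; rewrite expfz_neq0 ?xa0.
by apply: contraNneq => ->; rewrite scale0r.
Qed.

Lemma ord_pole_coef P J phi :
  ord P (pole_coef J phi)%:A = - (\sum_l J l * ord P (xa l)) - phi%:Z * ord P (pe w).
Proof.
have xaz l : xa l ^ (- J l) != 0 by rewrite expfz_neq0 ?xa0.
have prod0 : \prod_l xa l ^ (- J l) != 0 by apply/prodf_neq0.
rewrite pole_coefE ordM ?invr_eq0 ?expf_neq0 //.
rewrite ord_prod // ordV ?expf_neq0 // ordX //; congr (_ - _).
by rewrite -sumrN; apply: eq_bigr => l _; rewrite ordXz ?xa0 // mulNr.
Qed.

Lemma m_ord_term P (r : k) (i : nat) : r != 0 ->
  m%:Z * ord P (r%:A * y ^+ i)
    = m%:Z * ord P r%:A + i%:Z * (ord P (pe d) + q.+1%:Z * ord P (pe w)).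
Proof.
move=> r0; have rA : r%:A != 0 :> F by rewrite scaler_eq0 oner_eq0 orbF.
rewrite ordM ?expf_neq0 // ordX // -(ord_y q_gt1 pcharq m_gt0 yE); ring.
Qed.

Lemma alpha_inj : injective alpha.
Proof. by move=> l l' e; apply/Q_inj/place_is_Q; rewrite -e. Qed.

Lemma ord_Q_xa l l' : ord (Q l) (xa l') = if l' == l then m%:Z else 0.
Proof.
case: eqVneq => [->|ne].
  rewrite -(ord_y_over q_gt1 pcharq m_gt0 yE (d_alpha l) (Q_alpha l)).
  by rewrite (ord_y_over1 q_gt1 pcharq m_gt0 yE y_gen (d_alpha l) (Q_alpha l)) mulr1.
apply: (ord_over_nonroot (Q_alpha l)); rewrite root_XsubC.
by apply: contra ne => /eqP/alpha_inj ->.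
Qed.

Lemma ord_Q_dw l : ord (Q l) (pe d) = m%:Z /\ ord (Q l) (pe w) = 0.
Proof.
have dv : 'X - (alpha l)%:P %| d by rewrite dvdp_XsubCl.
have := ord_BM_dw_cases q_gt1 pcharq (irredp_XsubC (alpha l)) (ord_x_over (Q_alpha l)) (Q_alpha l).
by rewrite dv ord_Q_xa eqxx => -[[]|[_ []]|[]].
Qed.

Lemma ord_Q_pole_coef l J phi : ord (Q l) (pole_coef J phi)%:A = - (m%:Z * J l).
Proof.
rewrite ord_pole_coef (ord_Q_dw l).2 mulr0 subr0 (bigD1 l) //= ord_Q_xa eqxx.
rewrite big1 ?addr0 1?mulrC // => l' ne.
by rewrite ord_Q_xa (negbTE ne) mulr0.
Qed.

Lemma ord_Q_x l : 0 <= ord (Q l) x.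
Proof. exact: ord_x_over (Q_alpha l). Qed.

Lemma ord_infty P : ord P x < 0 ->
  [/\ forall l, ord P (xa l) = ord P x,
      ord P (pe d) = q.+1%:Z * ord P x
    & ord P (pe w) = (q%:Z ^+ 2 - q%:Z - 1) * ord P x].
Proof.
move=> h; split=> [l||].
- by rewrite ord_poly_infty ?polyXsubC_eq0 // size_XsubC mul1r.
- by rewrite ord_poly_infty ?BM_d_neq0 // size_BM_d.
- rewrite ord_poly_infty ?BM_w_neq0 // size_BM_w //; congr (_ * _).
  have : (q < q ^ 2)%N by rewrite -{1}(expn1 q) ltn_exp2l.
  by rewrite -mulnn expr2 -PoszM; move: (q * q)%N => qq; lia.
Qed.

(** This is regularity of [pole_coef J phi] times y^i at a pole of x, scaled by [m], where [S] is
    the sum of the [J l] and phi = floor(i(q+1)/m) is the largest exponent that creates no pole at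
    the zeros of [w]. *)
Definition pole_bound (i : nat) (S : int) : bool :=
  i%:Z * (q%:Z ^+ 3 - q%:Z)
    <= m%:Z * (S + (q%:Z ^+ 2 - q%:Z - 1) * (i * q.+1 %/ m)%N%:Z).

Lemma regular_term_exists (i : 'I_m) J : pole_bound i (\sum_l J l) ->
  exists r : k, [/\ r != 0, regular_outside Q (r%:A * y ^+ i)
    & forall l, ord (Q l) (r%:A * y ^+ i) = i%:Z - m%:Z * J l].
Proof.
move=> bd; set phi := (i * q.+1 %/ m)%N in bd.
have phile : (phi * m <= i * q.+1)%N by apply: leq_trunc_div.
exists (pole_coef J phi); have r0 := pole_coef_neq0 J phi; split=> // [P PQ|l].
  rewrite -(@pmulr_rge0 _ m%:Z) ?ltz_nat // m_ord_term // ord_pole_coef.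
  have [hx|hx] := leP 0 (ord P x).
    have xaP l : ord P (xa l) = 0.
      apply/eqP; rewrite eq_le ord_poly_nneg // andbT leNgt; apply/negP => h.
      by apply: (PQ l); apply: place_is_Q.
    rewrite big1 => [|l _]; last by rewrite xaP mulr0.
    have hd := ord_poly_nneg d hx; have hw := ord_poly_nneg w hx.
    have -> : m%:Z * (- 0 - phi%:Z * ord P (pe w)) + i%:Z * (ord P (pe d) + q.+1%:Z * ord P (pe w))
      = i%:Z * ord P (pe d) + ((i * q.+1)%N%:Z - (phi * m)%N%:Z) * ord P (pe w).
      by rewrite !PoszM; ring.
    by rewrite addr_ge0 // mulr_ge0 // subr_ge0 lez_nat.
  have [xaP -> ->] := ord_infty hx.
  rewrite (eq_bigr (fun l => J l * ord P x)) => [|l _]; last by rewrite xaP.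
  rewrite -mulr_suml; set S := \sum_l _ in bd *.
  set o := ord P x in hx *.
  have -> : m%:Z * (- (S * o) - phi%:Z * ((q%:Z ^+ 2 - q%:Z - 1) * o)) +
     i%:Z * (q.+1%:Z * o + q.+1%:Z * ((q%:Z ^+ 2 - q%:Z - 1) * o))
   = (i%:Z * (q%:Z ^+ 3 - q%:Z) - m%:Z * (S + (q%:Z ^+ 2 - q%:Z - 1) * phi%:Z)) * o.
    by rewrite -(addn1 q) PoszD; ring.
  by rewrite nmulr_lge0 // subr_le0.
apply: (@mulfI _ m%:Z); first by rewrite -lt0n.
rewrite m_ord_term // ord_Q_pole_coef; have [-> ->] := ord_Q_dw l; ring.
Qed.

(** The quotient [h] of [r] by [pole_coef J phi] must be a polynomial, and a polynomial factor only
    makes the order at a pole of x worse, so the bound holds for [pole_coef J phi] already. *)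
Lemma regular_term_bound (i : 'I_m) J (r : k) : r != 0 ->
  regular_outside Q (r%:A * y ^+ i) ->
  (forall l, ord (Q l) r%:A = - (m%:Z * J l)) -> pole_bound i (\sum_l J l).
Proof.
move=> r0 reg ordr; set phi := (i * q.+1 %/ m)%N.
have mz : 0 < m%:Z by rewrite ltz_nat.
have phile : (phi * m <= i * q.+1)%N by apply: leq_trunc_div.
have phigt : (i * q.+1 < phi * m + m)%N by rewrite -mulSnr ltn_ceil.
have [c c0 [ordc ordQc]] : exists2 c : k, c != 0 &
    (forall P, ord P c%:A = - (\sum_l J l * ord P (xa l)) - phi%:Z * ord P (pe w))
    /\ (forall l, ord (Q l) c%:A = - (m%:Z * J l)).
  exists (pole_coef J phi); first exact: pole_coef_neq0.
  by split=> [P|l]; [exact: ord_pole_coef|exact: ord_Q_pole_coef].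
have [h h0 ord_r] := ord_quotient (ff_const F) r0 c0.
have [a [b [b0 cop eh]]] := fraction_quotient_coprime F h.
have a0 : a != 0.
  apply: contraNneq h0 => a0; move/eqP: eh.
  by rewrite a0 rmorph0 mul0r scaler_eq0 oner_eq0 orbF.
have ord_h P : ord P h%:A = ord P (pe a) - ord P (pe b).
  by rewrite eh ordM ?invr_eq0 ?ff_poly_eq0 // ordV ?ff_poly_eq0.
have size_b : size b = 1%N.
  apply/eqP; rewrite eqn_leq size_poly_gt0 b0 andbT leqNgt; apply/negP => b1.
  have [t irt /dvdpP[b' eb]] := irreducible_divisor b1.
  have [P [hx ht]] := place_over_irreducible F irt.
  have t0 : t != 0 := irredp_neq0 irt.
  have b'0 : b' != 0 by apply: contraNneq b0 => e; rewrite eb e mul0r.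
  have orda : ord P (pe a) = 0.
    apply: ord_poly_coprime hx ht _; rewrite coprimep_sym.
    by apply: coprimep_dvdl cop; rewrite eb dvdp_mull.
  have oh : ord P h%:A <= - ord P (pe t).
    rewrite ord_h orda sub0r lerN2 eb rmorphM ordM ?ff_poly_eq0 //.
    by rewrite lerDr ord_poly_nneg.
  (* Regularity says nothing at [Q l], but there [r] and [pole_coef J phi] have equal values, so [h]
     has no pole. *)
  have [[l Pl]|noQ] := pselect (exists l, 0 < ord P (xa l)).
    have := oh; rewrite (place_is_Q Pl) leNgt => /negP; apply.
    have := ord_r (Q l); rewrite ordr ordQc => /eqP.
    rewrite -{1}[- _]add0r (inj_eq (addIr _)) => /eqP <-.
    by rewrite oppr_lt0 -(place_is_Q Pl).
  have xaP l : ord P (xa l) = 0.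
    apply/eqP; rewrite eq_le ord_poly_nneg // andbT leNgt; apply/negP => hl.
    by apply: noQ; exists l.
  have PQ l : P <> Q l.
    by move=> e; apply: noQ; exists l; rewrite e.
  have := reg P PQ; rewrite -(@pmulr_rge0 _ m%:Z) // m_ord_term // ord_r ordc.
  rewrite big1 => [|l _]; last by rewrite xaP mulr0.
  rewrite leNgt => /negP; apply.
  move: oh ht; set o := ord P h%:A; set e := ord P (pe t) => oh e0.
  have im : i%:Z < m%:Z by rewrite ltz_nat.
  case: (ord_BM_dw_cases q_gt1 pcharq irt hx e0) => [[_ [-> ->]]|[_ [-> ->]]|[_ [-> ->]]].
  - have -> : m%:Z * (o + (- 0 - phi%:Z * 0)) + i%:Z * (0 + q.+1%:Z * 0) = m%:Z * o by ring.
    by rewrite pmulr_rlt0 //; apply: le_lt_trans oh _; rewrite oppr_lt0.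
  - rewrite -/e.
    have -> : m%:Z * (o + (- 0 - phi%:Z * 0)) + i%:Z * (e + q.+1%:Z * 0) = m%:Z * o + i%:Z * e by ring.
    apply: (@le_lt_trans _ _ (m%:Z * - e + i%:Z * e)); first by rewrite lerD2r ler_pM2l.
    by rewrite mulrN addrC subr_lt0 ltr_pM2r.
  - rewrite -/e; set ph := phi%:Z.
    have -> : m%:Z * (o + (- 0 - ph * e)) + i%:Z * (0 + q.+1%:Z * e)
      = m%:Z * o + ((i * q.+1)%N%:Z - (phi * m)%N%:Z) * e.
      by rewrite !PoszM -/ph; ring.
    apply: (@le_lt_trans _ _ (m%:Z * - e + ((i * q.+1)%N%:Z - (phi * m)%N%:Z) * e)).
      by rewrite lerD2r ler_pM2l.
    rewrite mulrN addrC subr_lt0 ltr_pM2r // ltrBlDr addrC -PoszD ltz_nat.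
    by [].
have [P hx] := place_over_infinity F.
have PQ l : P <> Q l by move=> e; move: hx; rewrite e ltNge ord_Q_x.
have := reg P PQ; rewrite -(@pmulr_rge0 _ m%:Z) // m_ord_term // ord_r ordc.
rewrite ord_h (ord_poly_infty hx a0) (ord_poly_infty hx b0) size_b mul0r subr0.
have [xaP -> ->] := ord_infty hx.
rewrite (eq_bigr (fun l => J l * ord P x)) => [|l _]; last by rewrite xaP.
rewrite -mulr_suml /pole_bound -/phi; set S := \sum_l _.
set o := ord P x in hx *; set D := (size a).-1%:Z.
have -> : m%:Z * (D * o + (- (S * o) - phi%:Z * ((q%:Z ^+ 2 - q%:Z - 1) * o))) +
   i%:Z * (q.+1%:Z * o + q.+1%:Z * ((q%:Z ^+ 2 - q%:Z - 1) * o))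
 = (m%:Z * D + i%:Z * (q%:Z ^+ 3 - q%:Z) - m%:Z * (S + (q%:Z ^+ 2 - q%:Z - 1) * phi%:Z)) * o.
  by rewrite -(addn1 q) PoszD; ring.
rewrite nmulr_lge0 // subr_le0; apply: le_trans.
by rewrite lerDr mulr_ge0.
Qed.

Let mz_gt0 : 0 < m%:Z. Proof. by rewrite ltz_nat. Qed.
Let mz_neq0 : m%:Z != 0. Proof. by rewrite gt_eqF. Qed.

(** For i > 0 a pole order m J - i equals m (J - 1) + (m - i), so passing from [J] to the quotients
    in [level] costs 1 at each of the N places. *)
Variable thr : int -> int.
Hypothesis thrE : forall (i : 'I_m) S,
  (thr (power_class i) <= S) = pole_bound i (S + N%:Z * (i != 0%N :> nat)%:Z).

Lemma ord_termE (r : k) : r != 0 -> exists J, forall l (i : nat),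
  ord (Q l) (r%:A * y ^+ i) = i%:Z - m%:Z * J l.
Proof.
move=> r0; exists (fun l => - (ord (Q l) r%:A %/ m%:Z)%Z) => l i.
have [s hs] := ord_term_over1 q_gt1 pcharq m_gt0 yE y_gen (d_alpha l) r0.
have := hs _ (Q_alpha l) 0%N; rewrite expr0 mulr1 addr0 => ->.
by rewrite hs // mulrC mulzK //; ring.
Qed.

Lemma BM_HhatP (a : 'rV[int]_N) : Hhat Q a <->
  forall l, thr (residue m a l) <= level m a (residue m a l).
Proof.
have osum l g := @ord_sum_over _ _ _ _ _ q_gt1 pcharq m_gt0 yE _ (d_alpha l) (Q l) g (Q_alpha l).
split=> [[z [reg z0 ea]] l|h].
  have [g ez] := kummer_decomposition m_gt0 yE y_gen z.
  have gn0 : exists i, g i != 0.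
    apply: contrapT => no; move: z0; rewrite ez big1 ?eqxx // => i _.
    by case: (eqVneq (g i) 0) => [->|gi]; [rewrite scale0r mul0r|case: no; exists i].
  (* The term that realises the value of [z] at [Q l] carries the residue of [a 0 l]. At every other
     [Q l'] its pole order is at most [a 0 l'], so its [J] is bounded by the level. *)
  have [_ [i [gi e _]]] := osum l g gn0.
  have regi : regular_outside Q ((g i)%:A * y ^+ i).
    by apply: regular_component; rewrite -ez.
  have [J hJ] := ord_termE gi.
  have bd : pole_bound i (\sum_l' J l').
    apply: regular_term_bound gi regi _ => l'.
    by have := hJ l' 0%N; rewrite expr0 mulr1 add0r.
  pose dl : int := (i != 0%N :> nat)%:Z.
  have pc := power_classE m_gt0 i; rewrite -/dl in pc.
  have aE l' : a 0 l' = - ord (Q l') z by rewrite ea mxE.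
  have -> : residue m a l = power_class i.
    rewrite /residue aE ez e hJ.
    have -> : - (i%:Z - m%:Z * J l) = (J l - dl) * m%:Z + power_class i by rewrite pc; ring.
    by rewrite modzMDl modz_small // power_class_bounds.
  apply: (@le_trans _ _ (\sum_l' (J l' - dl))).
    rewrite thrE; rewrite sumrB sumr_const card_ord -/dl.
    by rewrite -mulr_natl natz subrK.
  apply: ler_sum => l' _; rewrite lez_divRL // aE pc.
  have [_ [i' [_ e' hi']]] := osum l' g gn0.
  have := hi' i gi; rewrite -e' -ez hJ => le.
  have -> : (J l' - dl) * m%:Z = - (i%:Z - m%:Z * J l') - (dl * m%:Z - i%:Z) by ring.
  by rewrite lerD2r lerN2.
(* Each residue class that occurs in [a] receives a term whose pole order at every [Q l] is the
   largest number of that class up to [a 0 l]. In the sum, the class of [a 0 l] attains [a 0 l] at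
   [Q l] and no other term exceeds it. *)
have /boolp.choice[g hg] : forall i : 'I_m, exists r : k,
    if `[< exists l, residue m a l = power_class i >] then
      [/\ r != 0, regular_outside Q (r%:A * y ^+ i) & forall l,
        ord (Q l) (r%:A * y ^+ i) =
          - (((a 0%R l - power_class i) %/ m%:Z)%Z * m%:Z + power_class i)]
    else r = 0.
  move=> i; case: asboolP => [[l0 el0]|_]; last by exists 0.
  pose J l := ((a 0%R l - power_class i) %/ m%:Z)%Z + (i != 0%N :> nat)%:Z.
  have [|r [r0 reg ordr]] := @regular_term_exists i J.
    rewrite /J big_split /= sumr_const card_ord -mulr_natl natz.
    have := h l0; rewrite el0 thrE; exact.
  exists r; split=> // l; rewrite ordr /J power_classE //; ring.
have gP i : g i != 0 -> [/\ exists l, residue m a l = power_class i,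
    regular_outside Q ((g i)%:A * y ^+ i) & forall l, ord (Q l) ((g i)%:A * y ^+ i) =
          - (((a 0%R l - power_class i) %/ m%:Z)%Z * m%:Z + power_class i)].
  by have := hg i; case: asboolP => [ex [_ ? ?]|_ ->]; rewrite ?eqxx.
have gE l : exists2 i, g i != 0 & ord (Q l) ((g i)%:A * y ^+ i) = - a 0 l.
  have [i ei] := power_class_surj m_gt0 (residue_bounds m_gt0 a l).
  have gi : g i != 0.
    by have := hg i; case: asboolP => [_ []|no _] //; case: no; exists l.
  exists i => //; have [_ _ ->] := gP i gi; rewrite ei; congr (- _).
  by rewrite {2}(divz_eq (a 0 l) m%:Z) /residue {1}(divz_eq (a 0 l) m%:Z) addrK mulzK.
pose l0 : 'I_N := Ordinal N_gt0.
have gn0 : exists i, g i != 0 by have [i gi _] := gE l0; exists i.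
exists (\sum_i (g i)%:A * y ^+ i); split.
- move=> P PQ; apply: ord_nneg_sum => i; case: (eqVneq (g i) 0) => [->|gi].
    by rewrite scale0r mul0r Defs.ord0.
  by have [_ reg _] := gP i gi; apply: reg.
- by have [] := osum l0 g gn0.
- apply/rowP => l; rewrite mxE.
  have [_ [i [gi e hi]]] := osum l g gn0; have [j gj ej] := gE l.
  apply/eqP; rewrite eq_le; apply/andP; split.
    by rewrite lerNr e -ej hi.
  rewrite lerNl e; have [_ _ ->] := gP i gi; rewrite lerN2 -lerBrDr.
  by rewrite lez_floor // gt_eqF.
Qed.

End BMRegular.

(** * The thresholds *)

(** Residue 0 belongs to the index i = 0, where no shift by N occurs; the formula in [BM_beta] would
    give q + 1 - N there instead of 0. *)
Definition BM_threshold (q n N : nat) (c : int) : int :=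
  if c == 0 then 0 else BM_beta q n `|c|%N + 1 - N%:Z.

Lemma ceil_reflected (m i b : nat) : (0 < m)%N -> (i <= m)%N ->
  Num.ceil (((m - i)%N%:R * b%:R / m%:R) : rat) = b%:Z - (i * b %/ m)%N%:Z.
Proof.
move=> m0 im; have mr : (0 : rat) < m%:R by rewrite ltr0n.
have le1 : (i * b %/ m * m <= i * b)%N := leq_trunc_div _ _.
have lt1 : (i * b < (i * b %/ m).+1 * m)%N by rewrite ltn_ceil.
set t := (i * b %/ m)%N in le1 lt1 *.
have le2 : (t%:R * m%:R <= i%:R * b%:R :> rat) by rewrite -!natrM ler_nat.
have lt2 : (i%:R * b%:R < (t%:R + 1) * m%:R :> rat).
  by rewrite natr1 -!natrM ltr_nat.
apply: ceil_def; rewrite natrB // ltr_pdivlMr // ler_pdivrMr //.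
rewrite !intrB -!pmulrn ?mulr1z; apply/andP; split; lra.
Qed.

(** For i > 0 the residue is M' - i, and [BM_beta] is evaluated there. Its ceiling becomes q + 1 -
    floor(i(q+1)/M'), and the constants combine through q + 1 + (q^2 - q - 1)(q + 1) = q^3 - q. *)
Lemma BM_thresholdE (q n N : nat) (i : 'I_(q ^ n).+1) (S : int) :
  (BM_threshold q n N (power_class i) <= S)
    = pole_bound q (q ^ n).+1 i (S + N%:Z * (i != 0%N :> nat)%:Z).
Proof.
set m := (q ^ n).+1 in i *; have mz : 0 < m%:Z by [].
rewrite /BM_threshold power_classE //.
have im := ltn_ord i; have [i0|i0] := eqVneq (i : nat) 0%N.
  by rewrite i0 mul0r subr0 eqxx /pole_bound mul0n div0n mulr0 !addr0 mul0r pmulr_rge0 ?mulr0 ?addr0.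
rewrite /= mul1r mulr1.
have -> : m%:Z - i%:Z = (m - i)%N%:Z by rewrite subzn // ltnW.
have -> : ((m - i)%N%:Z == 0) = false by apply/negbTE; rewrite -lt0n subn_gt0.
rewrite absz_nat /BM_beta -/m.
have -> : (q%:R + 1 : rat) = q.+1%:R by rewrite natr1.
rewrite ceil_reflected ?(ltnW im) // /pole_bound.
set t := (i * q.+1 %/ m)%N; set fl := Num.floor _.
have flE (z : int) : (z <= fl) = (z * m%:Z <= (m%:Z - i%:Z) * (q%:Z ^+ 3 - q%:Z)).
  rewrite /fl real_floor_ge_int ?num_real // ler_pdivlMr ?ltr0n // natrB ?(ltnW im) //.
  rewrite -(ler_int rat) !intrM !intrB !rmorphXn /= -!pmulrn.
  by [].
transitivity (q%:Z + 1 + (q%:Z ^+ 2 - q%:Z - 1) * (q.+1%:Z - t%:Z) - N%:Z - S <= fl).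
  by move: ((_ - _) * _ : int) => u; lia.
rewrite flE -subr_ge0 -[RHS]subr_ge0; congr (0 <= _).
by rewrite -(addn1 q) PoszD; ring.
Qed.

Lemma finField_prim_root (K : finFieldType) (m : nat) : (m %| #|K|.-1)%N ->
  exists zeta : K, m.-primitive_root zeta.
Proof.
move=> /dvdnP[c ec]; have K1 : (0 < #|K|.-1)%N by rewrite -subn1 subn_gt0 finNzRing_gt1.
have /hasP[z _ zP] : has (#|K|.-1).-primitive_root [seq x <- enum K | x != 0].
  apply: has_prim_root => //.
  - apply/allP => x; rewrite mem_filter => /andP[x0 _]; rewrite unity_rootE.
    apply/eqP/(mulfI x0); rewrite mulr1 -exprS prednK; last by rewrite (ltn_trans _ (finNzRing_gt1 K)).
    exact: expf_card.
  - by rewrite filter_uniq // enum_uniq.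
  - rewrite size_filter -(cardC1 (0 : K)) cardE -size_filter.
    by rewrite enumT.
exists (z ^+ c); have := exp_prim_root zP c.
have c0 : (0 < c)%N by move: K1; rewrite ec muln_gt0 => /andP[].
by rewrite ec gcdnMr mulKn.
Qed.

Lemma const_residue_sets (m N : nat) (thr : int -> int) (a : 'rV[int]_N) (rho : int) :
  (0 < m)%N -> (0 < N)%N -> thr 0 = 0 ->
  (exists2 c, forall k, residue m a k = c & level m a c = thr c + rho) <->
  (exists (i : nat) (j : 'I_N -> int), [/\ (1 <= i <= m - 1)%N,
      \sum_k j k = thr i%:Z + rho & a = \row_k (m%:Z * j k + i%:Z)]) \/
  (exists j : 'I_N -> int, \sum_k j k = rho /\ a = \row_k (m%:Z * j k)).
Proof.
move=> m0 N0 thr0; have mz : m%:Z != 0 by rewrite eqz_nat -lt0n.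
have row_residue (j : 'I_N -> int) (i : nat) : (i < m)%N -> a = \row_k (m%:Z * j k + i%:Z) ->
    (forall k, residue m a k = i%:Z) /\ level m a i%:Z = \sum_k j k.
  move=> im ->.
  have hc k : residue m (\row_k0 (m%:Z * j k0 + i%:Z)) k = i%:Z.
    by rewrite /residue mxE mulrC modzMDl modz_small // ltz_nat im.
  split=> //; apply: eq_bigr => k _; rewrite mxE addrK.
  by rewrite mulKz.
split=> [[c hc lc]|[[i [j [/andP[i1 im] sj ea]]]|[j [sj ea]]]].
- have /andP[c0 cm] := residue_bounds m0 a (Ordinal N0); rewrite hc in c0 cm.
  case: c hc lc c0 cm => // i hc lc _ im; rewrite ltz_nat in im.
  have aE k : a 0 k = m%:Z * (a 0%R k %/ m%:Z)%Z + i%:Z.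
    by rewrite -(hc k) {1}(divz_eq (a 0 k) m%:Z) mulrC.
  rewrite (level_const m0 hc) in lc.
  have [i0|i0] := posnP i.
    right; exists (fun k => (a 0%R k %/ m%:Z)%Z); rewrite lc i0 thr0 add0r; split=> //.
    by apply/rowP => k; rewrite mxE {1}aE i0 addr0.
  left; exists i, (fun k => (a 0%R k %/ m%:Z)%Z); split=> //; first by lia.
  by apply/rowP => k; rewrite mxE -aE.
- have im' : (i < m)%N by lia.
  by have [hc hl] := row_residue j i im' ea; exists i%:Z; rewrite // hl.
- have ea' : a = \row_k (m%:Z * j k + 0%:Z) by rewrite ea; apply/rowP => k; rewrite !mxE addr0.
  by have [hc hl] := row_residue j 0%N m0 ea'; exists 0; rewrite // hl thr0 add0r.
Qed.

Theorem proposition4p3 (q n N : nat) (K : finFieldType)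
  (F : fieldExtType {fraction {poly K}}) (y : F)
  (hq : prime_power q) (hn3 : (3 <= n)%N) (hnodd : odd n)
  (hK : #|K| = (q ^ (2 * n))%N)
  (hF : BM_function_field q n y)
  (hN2 : (2 <= N)%N) (hNq : (N <= q.+1)%N)
  (Q : 'I_N -> place (ff_const F)) (hQinj : injective Q)
  (hQ : forall k, exists2 gamma : K,
      root ('X^(q.+1) - 1) gamma & lies_over_zero (Q k) gamma)
  (UpsilonHat Upsilon : set 'rV[int]_N) (rho : int)
  (hUpsilon :
    [/\ UpsilonHat = GammaHat Q, Upsilon = Gamma Q & rho = 0] \/
    [/\ UpsilonHat = LambdaHat Q, Upsilon = Lambda Q & rho = N%:Z - 2]) :
  let M' := (q ^ n).+1 in
  UpsilonHat =
    [set a | exists (i : nat) (j : 'I_N -> int),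
       [/\ (1 <= i <= M' - 1)%N,
           \sum_k j k = BM_beta q n i + 1 - N%:Z + rho
         & a = \row_k (M'%:Z * j k + i%:Z)]]
    `|`
    [set a | exists j : 'I_N -> int,
       \sum_k j k = rho /\ a = \row_k (M'%:Z * j k)]
  /\
  Upsilon =
    [set a | exists (i : nat) (j : 'I_N -> nat),
       [/\ (1 <= i <= M' - 1)%N,
           \sum_k (j k)%:Z = BM_beta q n i + 1 - N%:Z + rho
         & a = \row_k (M'%:Z * (j k)%:Z + i%:Z)]].
Proof.
move=> M'; have [p [e [p_prime e_gt0 qE]]] := hq.
have q_gt1 : (1 < q)%N by rewrite qE -(exp1n e) ltn_exp2r // prime_gt1.
have m_gt0 : (0 < M')%N by [].
have N_gt0 : (0 < N)%N by apply: ltnW.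
have pcharq : [pchar K].-nat q.
  have pK : p \in [pchar K].
    by apply: (@card_finPcharP _ p (e * (2 * n))) => //; rewrite hK qE -expnM.
  by rewrite qE pnatX pnatE // pK.
have [yE y_gen] := hF.
have {}yE : y ^+ M' = ff_poly F (BM_d K q * BM_w K q ^+ q.+1).
  rewrite yE /BM_w exprMn mulrA /BM_d.
  by rewrite !(rmorphM, rmorphXn, rmorphB, rmorph1).
(* The conjugations are defined over [K] because q^n + 1 divides q^(2n) - 1, the order of the
   multiplicative group. *)
have [zeta zetaP] : exists zeta : K, M'.-primitive_root zeta.
  apply: finField_prim_root; rewrite hK mulnC expnM -subn1.
  have -> : ((q ^ n) ^ 2 - 1 = (q ^ n - 1) * M')%N.
    by rewrite -[in LHS](exp1n 2) subn_sqr /M' addn1.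
  exact: dvdn_mull.
have /boolp.choice[alpha alphaP] : forall k : 'I_N, exists gamma : K,
    root ('X^(q.+1) - 1) gamma /\ lies_over_zero (Q k) gamma.
  by move=> k; have [gamma r l] := hQ k; exists gamma.
have d_alpha l : root (BM_d K q) (alpha l) by have [] := alphaP l.
have Q_alpha l : 0 < ord (Q l) (ff_poly F ('X - (alpha l)%:P)).
  have [_ [P0 P0pos over]] := alphaP l; have := over _ P0pos.
  by rewrite /ff_poly rmorphB.
have HhatE (a : 'rV[int]_N) := BM_HhatP q_gt1 pcharq m_gt0 yE y_gen zetaP N_gt0 hQinj
  d_alpha Q_alpha (thr := BM_threshold q n N) (@BM_thresholdE q n N) a.
have thr_pos (i : nat) : (1 <= i)%N -> BM_threshold q n N i%:Z = BM_beta q n i + 1 - N%:Z.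
  by move=> i1; rewrite /BM_threshold eqz_nat eqn0Ngt i1.
have rho_lt : rho < N%:Z by case: hUpsilon => -[_ _ ->]; lia.
have upE a : UpsilonHat a <->
    exists2 c, forall k, residue M' a k = c & level M' a c = BM_threshold q n N c + rho.
  case: hUpsilon => -[-> _ ->].
    apply: (iff_trans (GammaHatP m_gt0 hN2 HhatE a)).
    by split=> -[c hc lc]; exists c; rewrite ?addr0 //; rewrite addr0 in lc.
  exact: LambdaHatP m_gt0 hN2 HhatE a.
have upP a : UpsilonHat a <->
  (exists (i : nat) (j : 'I_N -> int), [/\ (1 <= i <= M' - 1)%N,
      \sum_k j k = BM_beta q n i + 1 - N%:Z + rho & a = \row_k (M'%:Z * j k + i%:Z)]) \/
  (exists j : 'I_N -> int, \sum_k j k = rho /\ a = \row_k (M'%:Z * j k)).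
  have thr0 : BM_threshold q n N 0 = 0 by rewrite /BM_threshold eqxx.
  rewrite upE (const_residue_sets a rho m_gt0 N_gt0 thr0).
  split=> -[[i [j [ib sj ea]]]|h]; [left|by right|left|by right].
    by exists i, j; split=> //; rewrite -thr_pos //; case/andP: ib.
  by exists i, j; split=> //; rewrite thr_pos //; case/andP: ib.
have UE : Upsilon = UpsilonHat `&` @positive_vectors N.
  by case: hUpsilon => -[-> -> _].
split; first by apply/seteqP; split=> a; rewrite /= => /upP.
rewrite UE; apply/seteqP; split=> a.
  move=> [/upP[[i [j [ib sj ea]]]|[j [sj ea]]] pos].
    (* Since i < M', a positive entry M' j + i excludes j <= -1. *)
    have j0 k : 0 <= j k.
      have := pos k; rewrite ea mxE; move: (j k) ib => u ib h.
      rewrite leNgt; apply/negP => u0.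
      have : M'%:Z * u <= - M'%:Z by rewrite -mulrN1 ler_pM2l //; lia.
      by lia.
    exists i, (fun k => `|j k|%N); split=> //.
      by rewrite -sj; apply: eq_bigr => k _; rewrite gez0_abs.
    by rewrite ea; apply/rowP => k; rewrite !mxE gez0_abs.
  (* The family with residue 0 contributes no positive vector: positive entries would make the sum
     at least N, but it equals [rho]. *)
  have : N%:Z <= \sum_k j k.
    have -> : N%:Z = \sum_(k < N) 1%:Z by rewrite sumr_const card_ord -mulr_natl natz mulr1.
    apply: ler_sum => k _; by have := pos k; rewrite ea mxE pmulr_rgt0.
  by rewrite sj leNgt rho_lt.
move=> [i [j [ib sj ea]]]; split.
  by apply/upP; left; exists i, (fun k => (j k)%:Z).
move=> k; rewrite ea mxE; apply: ltr_wpDl; first by rewrite mulr_ge0.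
by rewrite ltz_nat; case/andP: ib.
Qed.
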